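(* Let $g:\mathbb{R}\to\mathbb{R}$ be non-decreasing and left continuous, such that its continuous part $g^C$ is not constant on any interval of the form $(-\infty,t]$, and let $\gamma$ be the pseudoinverse of $g^C$. Suppose that $1\leqslant p<\infty$ and $D_g=\{d_1,d_2,\dots\}$. A subset $\mathcal{G}$ of $L_g^p(\mathbb{R},\mathbb{F})$ is totally bounded if and only if 1. $\{f(d_n):f\in\mathcal{G}\}\subset\mathbb{F}$ is bounded for each $d_n\in D_g$; 2. for every $\varepsilon>0$ there exists $n$ such that for any $f\in\mathcal{G}$, $$\sum_{k>n}|f(d_k)|^p\,\Delta g(d_k)<\varepsilon^p;$$ 3. for every $\varepsilon>0$ there is some $R$ such that, for any $f\in\mathcal{G}$, $$\int_{|x|>R}|f\circ\gamma(x)|^p\,\mathrm{d}x<\varepsilon^p;$$ 4. for every $\varepsilon>0$ there exists $\rho>0$ such that for every $f\in\mathcal{G}$ and $h\in\mathbb{R}$ with $|h|<\rho$, $$\int_{\mathbb{R}}|f\circ\gamma(x+h)-f\circ\gamma(x)|^p\,\mathrm{d}x<\varepsilon^p.$$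
   Context: $\mathbb{F}$ is $\mathbb{R}$ or $\mathbb{C}$. $\Delta g(t)=g(t^+)-g(t)$, where $g(t^+)$ is the right-hand limit, and $D_g=\{t\in\mathbb{R}:\Delta g(t)>0\}$ (a countable set, enumerated without repetition). $\mu_g$ is the Lebesgue–Stieltjes measure of $g$, with $\mu_g([x,y))=g(y)-g(x)$, defined on the complete $\sigma$-algebra given by Carathéodory's extension; $L^p_g(\mathbb{R},\mathbb{F})$ is the corresponding $L^p$ space (functions identified when equal $\mu_g$-a.e., so values at points of $D_g$ are well defined). The jump part of $g$ is $g^B(t)=\sum_{s\in[0,t)\cap D_g}\Delta g(s)$ for $t>0$ and $g^B(t)=-\sum_{s\in[t,0)\cap D_g}\Delta g(s)$ for $t\leqslant 0$; the continuous part is $g^C=g-g^B$. The pseudoinverse of $g^C$ is $\gamma:g^C(\mathbb{R})\to\mathbb{R}$, $\gamma(x)=\min\{t\in\mathbb{R}:g^C(t)=x\}$. For $f\in L^p_g(\mathbb{R},\mathbb{F})$, the function $f\circ\gamma$, defined on $g^C(\mathbb{R})$, is extended by zero to $\mathbb{R}$, and is regarded as an element of $L^p(\mathbb{R},\mathbb{F})$ (Lebesgue measure). A subset $U$ of a metric space is totally bounded if for every $\varepsilon>0$ it is covered by finitely many balls of radius $\varepsilon$ centered at points of $U$. *)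

(* Defs.v *)
From HB Require Import structures.
From mathcomp Require Import all_boot all_order all_algebra.
From mathcomp Require Import complex.
From mathcomp Require Import all_classical all_reals all_analysis.

Set Implicit Arguments.
Unset Strict Implicit.
Unset Printing Implicit Defensive.
Import Order.TTheory GRing.Theory Num.Theory.
Import numFieldNormedType.Exports.

Local Open Scope classical_set_scope.
Local Open Scope ring_scope.

Variant scalar_kind := RealScalars | ComplexScalars.

Definition scalar_field (R : realType) (k : scalar_kind) : numFieldType :=
  match k with RealScalars => R | ComplexScalars => R[i] end.

(* [modulus] is the absolute value, with values in R: the library norm of
   [R[i]] takes its values in [R[i]]. *)
Definition modulus (R : realType) (k : scalar_kind) : scalar_field R k -> R :=
  match k with
  | RealScalars => fun x : R => `|x|
  | ComplexScalars => fun z : R[i] => ComplexField.Normc.normc z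
  end.

Definition borel (R : realType) (k : scalar_kind) :=
  g_sigma_algebraType (@open (scalar_field R k)).

Record derivator (R : realType) := Derivator {
  derivator_fun :> R -> R ;
  derivator_nondecreasing : {homo derivator_fun : x y / x <= y} ;
  derivator_left_continuous :
    forall t, derivator_fun x @[x --> t^'-] --> derivator_fun t }.

Section jumps.
Context {R : realType}.
Implicit Types g : R -> R.

Definition jump g (t : R) : R := lim (g x @[x --> t^'+]) - g t.

Definition jump_set g : set R := [set t | 0 < jump g t].

Definition jump_part g (t : R) : R :=
  if 0 < t then fine (\esum_(s in `[0, t[ `&` jump_set g) (jump g s)%:E)
  else - fine (\esum_(s in `[t, 0[ `&` jump_set g) (jump g s)%:E).

Definition cont_part g (t : R) : R := g t - jump_part g t.

(* [pseudoinverse g x] is the minimum of the fibre of [x] under the continuous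
   part of [g]; it is [0] if that fibre has no minimum, in particular if [x] is
   not in the range of the continuous part. *)
Definition pseudoinverse g (x : R) : R :=
  xget 0 [set t | cont_part g t = x /\ forall s, cont_part g s = x -> t <= s].

Definition comp_pseudoinverse g (k : scalar_kind) (f : R -> scalar_field R k) :
    R -> scalar_field R k :=
  patch (fun=> 0) (range (cont_part g)) (f \o pseudoinverse g).

(* [d] enumerates [D] without repetition, the indices running over [I], which is
   either {1, 2, ...} or {1, ..., n} (the empty set when n = 0). *)
Definition enumeration (D : set R) (I : set nat) (d : nat -> R) : Prop :=
  (I = [set i | (0 < i)%N] \/ exists n, I = [set i | (0 < i <= n)%N]) /\
  set_bij I D d.

End jumps.

Section coitv_semiring.
Variable R : realType.

Definition coitv_type : Type := R.

Definition coitv : set (set R) :=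
  [set `[x.1, x.2[%classic | x in [set: R * R]].

Lemma is_coitv a b : coitv `[a, b[%classic.
Proof. by exists (a, b). Qed.
Hint Extern 0 (coitv _) => solve [apply: is_coitv] : core.

Lemma coitv0 : coitv set0.
Proof. by exists (1, 0) => //=; rewrite set_itv_ge ?bnd_simp//= ltr10. Qed.
Hint Resolve coitv0 : core.

Lemma coitvP X :
  coitv X <-> X = set0 \/ exists2 x, x.1 < x.2 & X = `[x.1, x.2[%classic.
Proof.
split=> [[x _ <-]|[->//|[x xlt ->]]]//.
case: (boolP (x.1 < x.2)) => x12; first by right; exists x.
by left; rewrite set_itv_ge.
Qed.

Lemma coitvI : setI_closed coitv.
Proof.
move=> _ _ [a _ <-] [b _ <-]; exists (Num.max a.1 b.1, Num.min a.2 b.2) => //=.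
apply/seteqP; split=> x /=; rewrite !in_itv/= ge_max lt_min.
  by move=> /andP[/andP[-> ->] /andP[-> ->]].
by case=> /andP[-> ->] /andP[-> ->].
Qed.

Lemma coitvD : semi_setD_closed coitv.
Proof.
move=> _ _ [a _ <-] /coitvP[|[b ltb]] ->.
  rewrite setD0; exists [set `[a.1, a.2[%classic].
  by split=> [//|? ->//||? ? -> ->//]; rewrite ?bigcup_set1.
exists [set `[a.1, Num.min a.2 b.1[%classic;
             `[Num.max a.1 b.2, a.2[%classic]; split.
- by rewrite finite_setU; split; exact: finite_set1.
- by move=> X [] ->.
- rewrite bigcup_setU !bigcup_set1; apply/seteqP; split=> x /=;
    rewrite !in_itv/= lt_min ge_max.
    move=> [/andP[-> ->]]; case: (ltP x b.1) => /= xb; first by move=> _; left.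
    by move/negP; rewrite -leNgt => ->; right.
  case=> [/andP[-> /andP[-> xb]]|/andP[/andP[-> bx] ->]]; split=> //.
    by rewrite leNgt xb.
  by rewrite ltNge bx andbF.
- move=> X Y [] -> [] -> // [x []] /=; rewrite !in_itv/= !lt_min !ge_max.
    move=> /andP[_ /andP[_ xb]] /andP[/andP[_ bx] _].
    by have := lt_trans (le_lt_trans bx xb) ltb; rewrite ltxx.
  move=> /andP[/andP[_ bx] _] /andP[_ /andP[_ xb]].
  by have := lt_trans (le_lt_trans bx xb) ltb; rewrite ltxx.
Qed.

Definition coitv_display : Type -> measure_display. Proof. exact. Qed.

HB.instance Definition _ := Pointed.on coitv_type.
HB.instance Definition _ :=
  @isSemiRingOfSets.Build (coitv_display R)
    coitv_type coitv coitv0 coitvI coitvD.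

End coitv_semiring.

Section stieltjes.
Context {R : realType}.
Local Open Scope ereal_scope.

(* [wlength g] sends [a, b[ to g b - g a when a <= b; it is the library function
   that only depends on the endpoints of an interval. [mu_ext] takes the infimum
   over the countable covers by measurable sets of the semiring, here by
   intervals [a, b[. *)
Definition stieltjes_outer (g : derivator R) : set R -> \bar R :=
  @mu_ext _ (coitv_type R) R (wlength g).

Section outer.
Variable g : derivator R.

Let wlength_ge0 (A : set (coitv_type R)) : 0 <= wlength g A.
Proof.
by rewrite -(wlength0 g) le_wlength//; exact: derivator_nondecreasing.
Qed.

HB.instance Definition _ := isOuterMeasure.Build R R (stieltjes_outer g)
  (@mu_ext0 _ (coitv_type R) R (wlength g) (wlength0 g) wlength_ge0)
  (@mu_ext_ge0 _ (coitv_type R) R (wlength g) wlength_ge0)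
  (@le_mu_ext _ (coitv_type R) R (wlength g))
  (@mu_ext_sigma_subadditive _ (coitv_type R) R (wlength g) wlength_ge0).

End outer.

Definition stieltjes (g : derivator R)
    : set (caratheodory_type (stieltjes_outer g)) -> \bar R :=
  stieltjes_outer g.

HB.instance Definition _ (g : derivator R) := isMeasure.Build _ _ _
  (@stieltjes g)
  (caratheodory_measure0 (stieltjes_outer g))
  (caratheodory_measure_ge0 (mu := stieltjes_outer g))
  (@caratheodory_measure_sigma_additive _ _ (stieltjes_outer g)).

End stieltjes.
Arguments stieltjes {R} g A.

(* Proved by transfer from the right-continuous function x |-> - g (- x), for
   which the library has intervals ]a, b]. *)
Section stieltjes_itv.
Variables (R : realType) (g : derivator R).

Let fl (x : R) := - g (- x).

Let fl_nd : {homo fl : x y / x <= y}.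
Proof. by move=> x y xy; rewrite lerN2 derivator_nondecreasing// lerN2. Qed.

Let fl_rc : right_continuous fl.
Proof.
move=> x; rewrite /fl; apply: cvgN.
have h := derivator_left_continuous (d:=g) (t:=-x).
apply: cvg_comp h.
move=> A /= [e e0 HA]; exists e => //= y /= xy ly; apply: HA => /=.
  by move: xy; rewrite /ball_/= -normrN opprB opprK addrC.
by rewrite ltrN2.
Qed.

#[local] HB.instance Definition _ := isCumulative.Build R _ R fl fl_nd fl_rc.

Lemma stieltjes_itv x y :
  x <= y -> stieltjes g `[x, y[%classic = (g y - g x)%:E.
Proof.
move=> xy; apply/eqP; rewrite eq_le; apply/andP; split.
- apply: ereal_inf_lbound.
  exists (fun k => if k is 0%N then `[x,y[%classic else set0).
    split; first by case=> [|i]; [exact: is_coitv|exact: coitv0].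
    by move=> t xt; exists 0%N.
  rewrite nneseries_recl//; last first.
    move=> k _; rewrite -(wlength0 g) le_wlength//.
    exact: derivator_nondecreasing.
  rewrite eseries_cond/= eseries0 ?adde0.
    by rewrite wlength_itv_bnd.
  by case=> // k _ _; rewrite wlength0.
- apply: le_ereal_inf_tmp => _ [A [mA XA] <-].
  have := @wlength_sigma_subadditive R fl.
  have /choice[b bA] : forall k, exists b : R * R, A k = `[b.1, b.2[%classic.
    by move=> k; have [b _ <-] := mA k; exists b.
  move=> /(_ `](-y), (-x)]%classic
             (fun k => `](-(b k).2), (-(b k).1)]%classic)) h.
  have -> : (g y - g x)%:E = wlength fl `](-y), (-x)]%classic.
    by rewrite wlength_itv_bnd ?lerN2// /fl !opprK addrC.
  apply: (le_trans (h _ _ _)).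
  + by move=> k; exact: is_ocitv.
  + exact: is_ocitv.
  + move=> t /=; rewrite in_itv/= => /andP[t1 t2].
    have [|k _] := XA (-t); first by rewrite /= in_itv/= lerNr t2 ltrNl t1.
    rewrite bA /= in_itv/= => /andP[h1 h2]; exists k => //=.
    by rewrite in_itv/= ltrNl h2 lerNr.
  + rewrite le_eqVlt; apply/orP; left; apply/eqP; apply: eq_eseriesr => k _.
    rewrite bA !wlength_itv/= !lte_fin ltrN2; case: ifP => // _.
    by rewrite /= /fl -!EFinB !opprK addrC.
Qed.
End stieltjes_itv.

Section Lp_space.
Context {R : realType} (k : scalar_kind) (g : derivator R) (p : R).

Definition mfun_class :=
  {mfun_(stieltjes g), caratheodory_type (stieltjes_outer g) >-> borel R k}.

(* The representative of a class chosen by the quotient. The notions below, the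
   values at the points of [jump_set g] (atoms of the measure) and the Lebesgue
   class of [comp_pseudoinverse g] do not depend on this choice. *)
Definition class_fun (f : mfun_class) : R -> scalar_field R k :=
  aqEqMfun_to_fun f.

Definition Lp_set : set mfun_class :=
  [set f | finite_norm (stieltjes g) p%:E (@modulus R k \o class_fun f)].

Definition Lp_dist (f h : mfun_class) : \bar R :=
  ('N[stieltjes g]_(p%:E)
    [EFin \o (fun t => modulus (class_fun f t - class_fun h t))%R])%E.

End Lp_space.

Definition totally_bounded (R : realType) (T : Type) (dist : T -> T -> \bar R)
    (U : set T) : Prop :=
  forall eps : R, 0 < eps -> exists C : set T,
    [/\ finite_set C, C `<=` U &
        U `<=` \bigcup_(c in C) [set x | (dist c x < eps%:E)%E]].

(* Main.v *)
(* On Borel sets, mu_g is the sum of its atoms at the points of D_g and of the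
   image under gamma of Lebesgue measure on the range of g^C, and every
   mu_g-measurable function agrees with a Borel one off a Borel mu_g-null set.
   Hence the p-th power of the distance of f and h in L^p_g is
     \sum_i |f(d_i) - h(d_i)|^p Delta g(d_i) + \int |f \o gamma - h \o gamma|^p,
   and total boundedness amounts to a criterion in a weighted l^p (conditions 1
   and 2) and the Kolmogorov-Riesz criterion in L^p(R) (conditions 3 and 4). The
   Minkowski inequality is replaced by (a + b)^p <= 2^p (a^p + b^p).

   For sufficiency in L^p(R), functions are compared with step functions whose
   values are sampled rather than averaged: if the translates of F by less than
   delta are within eta of F, then Tonelli's theorem gives points z_j such that
   the integrals of |F - F(z_j)|^p over consecutive cells of length delta sum to
   at most 3 eta, and the values F(z_j), being bounded, can be discretised. For
   necessity, each single function satisfies conditions 2, 3 and 4, and a finite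
   net makes the estimates uniform. *)

Require Import Defs.
From HB Require Import structures.
From mathcomp Require Import all_boot all_order all_algebra.
From mathcomp Require Import complex ring lra.
From mathcomp Require Import all_classical all_reals all_analysis.
From mathcomp Require Import unstable measurable_realfun.

Set Implicit Arguments.
Unset Strict Implicit.
Unset Printing Implicit Defensive.
Import Order.TTheory GRing.Theory Num.Theory.
Import numFieldNormedType.Exports.

Local Open Scope classical_set_scope.
Local Open Scope ring_scope.

(** * Scalars *)

Section scalars.
Context {R : realType} {k : scalar_kind}.
Implicit Types x y z : scalar_field R k.

(** The measure is given on Carathéodory sets and conditions 3 and 4 use completed Lebesgue measure,
    whereas the decomposition of the measure, Tonelli's theorem and regularity are applied to Borel
    functions. Hence one Borel version [V f] of each class is fixed. This is harmless: a null set
    contains no point of [jump_set g], and the part of the range of [cont_part g] that the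
    pseudoinverse sends into it is Lebesgue null. Sampling spares averages of scalar-valued
    functions and Hölder's inequality: every integral is that of a nonnegative function, and the two
    scalar fields are treated together through [modulus]. Losing a factor 2^p in the triangle
    inequality does no harm, since all thresholds are arbitrary. Neither condition 3 nor condition 4
    mentions the norms, yet sampled values can be discretised only if they are bounded. The bound
    comes from both conditions together, by translating a bounded interval into the tail. *)

Definition scalar_re : scalar_field R k -> R :=
  match k with RealScalars => fun x : R => x | ComplexScalars => fun z : R[i] => complex.Re z end.

Definition scalar_im : scalar_field R k -> R :=
  match k with RealScalars => fun=> 0 | ComplexScalars => fun z : R[i] => complex.Im z end.

(** The convention that [scalar_im] vanishes on real scalars makes one formula valid for both
    fields. *)
Lemma modulusE z : modulus z = Num.sqrt (scalar_re z ^+ 2 + scalar_im z ^+ 2).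
Proof.
rewrite /scalar_re /scalar_im; move: z; case: k => /= [x|[a b]] //.
by rewrite expr0n addr0 sqrtr_sqr.
Qed.

Lemma scalar_reB x y : scalar_re (x - y) = scalar_re x - scalar_re y.
Proof. by rewrite /scalar_re; move: x y; case: k => /= [//|[a b] [c e]]. Qed.

Lemma scalar_imB x y : scalar_im (x - y) = scalar_im x - scalar_im y.
Proof.
rewrite /scalar_im; move: x y; case: k => /= [x y|[a b] [c e]] //.
by rewrite subr0.
Qed.

Lemma scalar_re0 : scalar_re 0 = 0.
Proof. by rewrite /scalar_re; case: k. Qed.

Lemma scalar_im0 : scalar_im 0 = 0.
Proof. by rewrite /scalar_im; case: k. Qed.

Lemma modulus_ge0 z : 0 <= modulus z.
Proof. by rewrite modulusE sqrtr_ge0. Qed.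

Lemma modulus0 : modulus (0 : scalar_field R k) = 0.
Proof. by rewrite modulusE scalar_re0 scalar_im0 !expr0n addr0 sqrtr0. Qed.

Lemma modulusB x y : modulus (x - y) = modulus (y - x).
Proof.
by rewrite !modulusE !scalar_reB !scalar_imB -sqrrN opprB -[X in _ + X]sqrrN opprB.
Qed.

Lemma ler_modulusD x y : modulus (x + y) <= modulus x + modulus y.
Proof.
move: x y; case: k => /= [x y|x y]; first exact: ler_normD.
have := ler_normD x y; rewrite !normc_def -rmorphD/= lecR.
by case: x y => [a b] [c e].
Qed.

Lemma modulus_triangle y x z : modulus (x - z) <= modulus (x - y) + modulus (y - z).
Proof. by rewrite -(subrKA y) ler_modulusD. Qed.

Lemma modulus_re z : `|scalar_re z| <= modulus z.
Proof. by rewrite modulusE -sqrtr_sqr ler_wsqrtr// lerDl sqr_ge0. Qed.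

Lemma modulus_im z : `|scalar_im z| <= modulus z.
Proof. by rewrite modulusE -sqrtr_sqr ler_wsqrtr// lerDr sqr_ge0. Qed.

Lemma modulus_le_reim z : modulus z <= `|scalar_re z| + `|scalar_im z|.
Proof.
rewrite modulusE; have h : 0 <= `|scalar_re z| + `|scalar_im z| by rewrite addr_ge0.
rewrite -[leRHS]ger0_norm// -sqrtr_sqr ler_wsqrtr// sqrrD !real_normK ?num_real//.
by rewrite addrAC lerDl mulrn_wge0// mulr_ge0.
Qed.

End scalars.

Section scalar_measurable.
Context {R : realType} {k : scalar_kind}.

(** Links the topology of the scalar field with the real-valued [modulus]. The two fields are
    treated apart because a ball of [R[i]] has its radius in [R[i]]. *)
Lemma scalar_lipschitz_continuous (u : scalar_field R k -> R) :
  (forall x y, `|u x - u y| <= modulus (x - y)) -> continuous u.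
Proof.
move: u; case: k => u ulip z; apply/(@cvgrPdist_lt _ _ _ (nbhs z) (nbhs_filter z)) => e e0.
  apply: filterS (@nbhsx_ballx _ (R : numFieldType) z _ e0) => y /=.
  exact/le_lt_trans/ulip.
have e0C : 0 < e%:C%C by rewrite ltcR.
apply: filterS (@nbhsx_ballx _ (R[i] : numFieldType) z _ e0C) => y /=.
rewrite /ball/= normc_def ltcR; apply/le_lt_trans/(le_trans (ulip _ _)).
by case: (z - y).
Qed.

Lemma scalar_re_continuous : continuous (@scalar_re R k).
Proof.
by apply: scalar_lipschitz_continuous => x y; rewrite -scalar_reB modulus_re.
Qed.

Lemma scalar_im_continuous : continuous (@scalar_im R k).
Proof.
by apply: scalar_lipschitz_continuous => x y; rewrite -scalar_imB modulus_im.
Qed.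

Lemma measurable_borel_comp d (T : measurableType d) (f : T -> borel R k)
    (u : scalar_field R k -> R) :
  measurable_fun setT f -> continuous u -> measurable_fun setT (u \o f).
Proof.
move=> mf /continuousP cu.
apply: (measurability _ (RGenOpens.measurableE R)).
move=> _ [V oV <-]; rewrite comp_preimage.
apply: mf => //; apply: sub_sigma_algebra.
have [x [y ->]] := oV; apply: cu; exact: interval_open.
Qed.

End scalar_measurable.

Section scalar_functions.
Context {R : realType} {k : scalar_kind}.

(** Measurability by components reduces differences and extensions by zero to the case of real
    functions. *)
Definition scalar_measurable d (T : measurableType d) (F : T -> scalar_field R k) :=
  measurable_fun setT (scalar_re \o F) /\ measurable_fun setT (scalar_im \o F).

Lemma borel_scalar_measurable d (T : measurableType d) (f : T -> borel R k) :
  measurable_fun setT f -> scalar_measurable f.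
Proof.
move=> mf; split; apply: measurable_borel_comp => //.
  exact: scalar_re_continuous.
exact: scalar_im_continuous.
Qed.

Lemma scalar_measurable_comp d1 d2 (T1 : measurableType d1) (T2 : measurableType d2)
    (F : T2 -> scalar_field R k) (g : T1 -> T2) :
  scalar_measurable F -> measurable_fun setT g -> scalar_measurable (F \o g).
Proof.
move=> [mr mi] mg; split; first exact: (measurableT_comp mr mg).
exact: (measurableT_comp mi mg).
Qed.

Lemma scalar_measurable_cst d (T : measurableType d) (c : scalar_field R k) :
  scalar_measurable (fun _ : T => c).
Proof. by split; exact: measurable_cst. Qed.

Lemma scalar_measurableB d (T : measurableType d) (F G : T -> scalar_field R k) :
  scalar_measurable F -> scalar_measurable G ->
  scalar_measurable (fun x => F x - G x).
Proof.
move=> [? ?] [? ?]; split.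
  rewrite (_ : _ \o _ = (scalar_re \o F) \- (scalar_re \o G)).
    exact: measurable_funB.
  by apply/funext => x /=; rewrite scalar_reB.
rewrite (_ : _ \o _ = (scalar_im \o F) \- (scalar_im \o G)).
  exact: measurable_funB.
by apply/funext => x /=; rewrite scalar_imB.
Qed.

Lemma measurable_modulus d (T : measurableType d) (F : T -> scalar_field R k) :
  scalar_measurable F -> measurable_fun setT (@modulus R k \o F).
Proof.
move=> [mr mi].
rewrite (_ : _ \o _ = Num.sqrt \o (fun x => (scalar_re (F x)) ^+ 2 + (scalar_im (F x)) ^+ 2)).
  apply: measurableT_comp.
  exact: (continuous_measurable_fun (@sqrt_continuous R)).
  by apply: measurable_funD; apply: measurable_funX.
by apply/funext => x /=; rewrite modulusE.
Qed.

Definition emodulus_pow (p : R) (z : scalar_field R k) : \bar R := (modulus z `^ p)%:E.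

Lemma emodulus_pow_ge0 p z : (0 <= emodulus_pow p z)%E.
Proof. by rewrite lee_fin powR_ge0. Qed.

Lemma measurable_emodulus_pow d (T : measurableType d) p (F : T -> scalar_field R k) :
  scalar_measurable F -> measurable_fun setT (emodulus_pow p \o F).
Proof.
move=> mF; apply/measurable_EFinP => /=.
rewrite (_ : (fun _ => _) = (@powR R)^~ p \o (@modulus R k \o F)) //.
by apply: measurableT_comp; [exact: measurable_powR|exact: measurable_modulus].
Qed.

End scalar_functions.
#[global] Hint Extern 0 (is_true (_ <= emodulus_pow _ _)%E) =>
  solve [exact: emodulus_pow_ge0] : core.

(** * Quasi-triangle inequality for p-th powers *)

Section quasi_triangle.
Context {R : realType}.
Variable p : R.
Hypothesis p1 : 1 <= p.
Let p0 : 0 < p. Proof. exact: lt_le_trans p1. Qed.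

(** [c] is at most twice the larger of [a] and [b], and the p-th power of the larger one is a term
    of the sum. *)
Lemma powRD_le (a b c : R) : 0 <= a -> 0 <= b -> 0 <= c -> c <= a + b ->
  c `^ p <= 2 `^ p * (a `^ p + b `^ p).
Proof.
move=> a0 b0 c0 cab; wlog ab : a b a0 b0 cab / a <= b.
  move=> W; have [ab|/ltW ba] := leP a b; first exact: W.
  by rewrite addrC; apply: W => //; rewrite addrC.
have c2b : c <= 2 * b by rewrite (le_trans cab)// mulr2n mulrDl mul1r lerD2r.
apply: (@le_trans _ _ ((2 * b) `^ p)).
  by rewrite ge0_ler_powR ?nnegrE ?mulr_ge0// ltW.
by rewrite powRM// ler_wpM2l ?powR_ge0// lerDr powR_ge0.
Qed.

Context {k : scalar_kind}.
Implicit Types x y z : scalar_field R k.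

Lemma emodulus_pow_triangle y x z :
  (emodulus_pow p (x - z) <=
   (2 `^ p)%:E * (emodulus_pow p (x - y) + emodulus_pow p (y - z)))%E.
Proof.
rewrite -EFinD -EFinM lee_fin; apply: powRD_le; rewrite ?modulus_ge0//.
exact: modulus_triangle.
Qed.

Lemma emodulus_powB x y : emodulus_pow p (x - y) = emodulus_pow p (y - x).
Proof. by rewrite /emodulus_pow modulusB. Qed.

Lemma emodulus_pow0 : emodulus_pow p (0 : scalar_field R k) = 0%E.
Proof. by rewrite /emodulus_pow modulus0 powR0// gt_eqF. Qed.

Lemma integral_emodulus_triangle d (T : measurableType d)
    (mu : {measure set T -> \bar R}) (D : set T) (G F H : T -> scalar_field R k) :
  measurable D ->
  scalar_measurable F -> scalar_measurable G -> scalar_measurable H ->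
  (\int[mu]_(x in D) emodulus_pow p (F x - H x) <=
   (2 `^ p)%:E * (\int[mu]_(x in D) emodulus_pow p (F x - G x) +
                  \int[mu]_(x in D) emodulus_pow p (G x - H x)))%E.
Proof.
move=> mD mF mG mH.
have m (A B : T -> scalar_field R k) :
    scalar_measurable A -> scalar_measurable B ->
    measurable_fun D (fun x : T => emodulus_pow p (A x - B x)).
  move=> mA mB; apply: measurable_funTS.
  exact: (measurable_emodulus_pow p (scalar_measurableB mA mB)).
rewrite -ge0_integralD//; [|exact: m..].
rewrite -ge0_integralZl//; last 2 first.
- by apply: emeasurable_funD; exact: m.
- by move=> x _; rewrite adde_ge0.
apply: ge0_le_integral => //.
- exact: m.
- by apply: emeasurable_funM => //; apply: emeasurable_funD; exact: m.
- by move=> x _; exact: emodulus_pow_triangle.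
Qed.

End quasi_triangle.

(** * The Stieltjes measure on Borel sets *)

Section stieltjes_borel.
Context {R : realType}.
Variable g : derivator R.
Local Open Scope ereal_scope.

Let stieltjes_itvE (x y : R) : (x < y)%R ->
  stieltjes_outer g `[x, y[%classic = (g y - g x)%:E.
Proof. by move=> xy; rewrite -(stieltjes_itv g (ltW xy)). Qed.

(** It suffices to cut the intervals of a cover: [y] divides a half-open interval into two intervals
    of the same shape, whose lengths add up exactly. *)
Lemma stieltjes_ray_caratheodory (y : R) :
  (stieltjes_outer g).-cara.-measurable `]-oo, y[%classic.
Proof.
apply: le_caratheodory_measurable => X.
apply: le_ereal_inf_tmp => _ [B [mB XB] <-].
pose A : set R := `]-oo, y[%classic.
have BA k : stieltjes_outer g (B k `&` A) + stieltjes_outer g (B k `&` ~` A) <=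
    wlength g (B k).
  have [->|[[a b]/= ab ->]] := (coitvP (B k)).1 (mB k).
    by rewrite !set0I wlength0 outer_measure0 adde0.
  rewrite wlength_itv_bnd; last exact: ltW.
  have [by_|yb] := leP b y.
    rewrite (_ : _ `&` A = `[a, b[%classic); last first.
      apply/seteqP; split=> x /=; rewrite /A/= !in_itv/=; first by case.
      by move=> /andP[-> xb]; rewrite xb (lt_le_trans xb).
    rewrite (_ : _ `&` ~` A = set0) ?outer_measure0 ?adde0 ?stieltjes_itvE//.
    apply/seteqP; split=> x //=; rewrite /A/= !in_itv/= => -[/andP[_ xb]].
    by rewrite (lt_le_trans xb).
  have [ya|ay] := leP y a.
    rewrite (_ : _ `&` A = set0); last first.
      apply/seteqP; split=> x //=; rewrite /A/= !in_itv/= => -[/andP[ax _]].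
      by rewrite ltNge (le_trans ya).
    rewrite (_ : _ `&` ~` A = `[a, b[%classic); last first.
      apply/seteqP; split=> x /=; rewrite /A/= !in_itv/=; first by case.
      by move=> /andP[ax ->]; rewrite ax; split => //; rewrite ltNge (le_trans ya).
    by rewrite outer_measure0 add0e stieltjes_itvE.
  rewrite (_ : _ `&` A = `[a, y[%classic); last first.
    apply/seteqP; split=> x /=; rewrite /A/= !in_itv/=.
      by move=> [/andP[-> _] ->].
    by move=> /andP[-> xy]; rewrite xy (lt_trans xy).
  rewrite (_ : _ `&` ~` A = `[y, b[%classic); last first.
    apply/seteqP; split=> x /=; rewrite /A/= !in_itv/=.
      by move=> [/andP[_ ->] /negP]; rewrite -leNgt => ->.
    move=> /andP[yx ->]; rewrite (le_trans (ltW ay) yx); split => //.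
    by apply/negP; rewrite -leNgt.
  rewrite !stieltjes_itvE// -EFinD lee_fin addrC.
  by rewrite addrA subrK.
apply: (@le_trans _ _ (\sum_(0 <= k <oo) (stieltjes_outer g (B k `&` A) +
    stieltjes_outer g (B k `&` ~` A)))).
  rewrite nneseriesD; last 2 first.
  - by move=> k _ _; exact: outer_measure_ge0.
  - by move=> k _ _; exact: outer_measure_ge0.
  have sub (C : set R) : stieltjes_outer g (X `&` C) <=
      \sum_(0 <= k <oo) stieltjes_outer g (B k `&` C).
    apply: le_trans (outer_measure_sigma_subadditive (stieltjes_outer g) _).
    by apply: le_outer_measure; rewrite -setI_bigcupl; exact: setSI.
  by apply: leeD; exact: sub.
by apply: lee_nneseries => k _ //; rewrite adde_ge0// outer_measure_ge0.
Qed.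

Lemma borel_caratheodory (A : set R) : measurable A ->
  (stieltjes_outer g).-cara.-measurable A.
Proof.
rewrite [X in X -> _](_ : _ = (@RGenInftyO.G R).-sigma.-measurable A); last first.
  by rewrite -RGenInftyO.measurableE.
apply: smallest_sub => [|_ [y ->]]; last exact: stieltjes_ray_caratheodory.
exact: sigma_algebra_measurable.
Qed.

(** The same set function, seen on the Borel sets, where it can be compared with image measures and
    identified by its values on intervals. *)
Definition stieltjes_borel : set R -> \bar R := stieltjes g.

Let stieltjes_borel0 : stieltjes_borel set0 = 0.
Proof. exact: measure0. Qed.

Let stieltjes_borel_ge0 A : 0 <= stieltjes_borel A.
Proof. exact: outer_measure_ge0. Qed.

Let stieltjes_borel_sigma_additive : semi_sigma_additive stieltjes_borel.
Proof.
move=> F mF tF mUF; apply: (@measure_semi_sigma_additive _ _ _ (stieltjes g)) => //.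
  by move=> i; exact: borel_caratheodory.
exact: borel_caratheodory.
Qed.

HB.instance Definition _ := isMeasure.Build _ _ _ stieltjes_borel
  stieltjes_borel0 stieltjes_borel_ge0 stieltjes_borel_sigma_additive.

(** The identity is measurable from the Carathéodory sets to the Borel sets, and [stieltjes_borel]
    is the image measure. *)
Lemma integral_stieltjes_borel (f : R -> \bar R) :
  measurable_fun setT f -> (forall x, 0 <= f x) ->
  \int[stieltjes g]_x f x = \int[stieltjes_borel]_x f x.
Proof.
move=> mf f0.
have mid : measurable_fun setT
    (id : caratheodory_type (stieltjes_outer g) -> R).
  by move=> _ A mA; rewrite setTI; exact: borel_caratheodory.
have := @ge0_integral_pushforward _ _ _ _ R _ mid (stieltjes g) setT f measurableT mf.
rewrite preimage_setT => <- //.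
Qed.

Lemma stieltjes_borel_itv (x y : R) : (x <= y)%R ->
  stieltjes_borel `[x, y[%classic = (g y - g x)%:E.
Proof. exact: stieltjes_itv. Qed.

Lemma measure_eq_stieltjes_borel (m : {measure set R -> \bar R}) :
  (forall x y : R, (x <= y)%R -> m `[x, y[%classic = (g y - g x)%:E) ->
  forall A : set R, measurable A -> stieltjes_borel A = m A.
Proof.
move=> mE A mA.
pose G := @coitv R.
have mG : @measurable _ R = <<s G >>.
  apply/seteqP; split.
    rewrite [X in X `<=` _](_ : _ = (@RGenInftyO.G R).-sigma.-measurable); last first.
      by rewrite -RGenInftyO.measurableE.
    apply: smallest_sub; first exact: smallest_sigma_algebra.
    move=> _ [y ->].
    rewrite (_ : `]-oo, y[%classic = \bigcup_n `[(- n%:R)%R, y[%classic); last first.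
      apply/seteqP; split=> x /=.
        rewrite in_itv/= => xy; exists (Num.bound x) => //=.
        by rewrite in_itv/= xy lerNl ltW// ltrNbound.
      by move=> [n _]; rewrite /= !in_itv/= => /andP[_ ->].
    apply: (@sigma_algebra_bigcup _ setT G) => n.
    by apply: sub_sigma_algebra; exact: is_coitv.
  apply: smallest_sub; first exact: sigma_algebra_measurable.
  by move=> _ [x _ <-]; exact: measurable_itv.
apply: (measure_unique G (fun n => `[(- n%:R)%R, n%:R[%classic)) => //.
- exact: coitvI.
- by move=> i; exact: is_coitv.
- apply/seteqP; split=> // x _.
  by exists (Num.bound x) => //=; rewrite in_itv/= ltr_bound lerNl ltW// ltrNbound.
- move=> _ [[x y] _ <-]/=; have [xy|yx] := leP x y.
    by rewrite stieltjes_borel_itv// mE.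
  by rewrite set_itv_ge ?bnd_simp -?leNgt ?ltW// !measure0.
- by move=> n; rewrite /= stieltjes_borel_itv ?ltry// (@le_trans _ _ 0%R)// lerNl oppr0.
Qed.

(** A countable union of intervals is Borel, and intersecting covers that are optimal up to 1/(n+1)
    removes the excess. Such covers exist when the outer measure is finite; otherwise the whole line
    serves. *)
Lemma borel_hull (X : set R) :
  exists B : set R, [/\ measurable B, X `<=` B & stieltjes_outer g B <= stieltjes_outer g X].
Proof.
have [Xoo|Xoo] := eqVneq (stieltjes_outer g X) +oo.
  by exists setT; split => //; rewrite Xoo leey.
have Xfin : stieltjes_outer g X \is a fin_num.
  by rewrite ge0_fin_numE ?outer_measure_ge0// ltey.
have h n : exists B : set R, [/\ measurable B, X `<=` B &
    stieltjes_outer g B <= stieltjes_outer g X + n.+1%:R^-1%:E].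
  have n0 : (0 < n.+1%:R^-1 :> R)%R by rewrite invr_gt0.
  have [_ [A [mA XA] <-] sA] := lb_ereal_inf_adherent n0 Xfin.
  exists (\bigcup_k A k); split => //.
    by apply: bigcupT_measurable => k; have [x _ <-] := mA k.
  apply: le_trans (ltW sA); apply: le_trans (outer_measure_sigma_subadditive _ _) _.
  apply: lee_nneseries => [k _ _|k _]; first exact: outer_measure_ge0.
  have [->|[x x12 ->]] := (coitvP (A k)).1 (mA k).
    by rewrite outer_measure0 wlength0.
  by rewrite /= stieltjes_itvE// wlength_itv_bnd// ltW.
have [B hB] := choice h.
exists (\bigcap_n B n); split.
- by apply: bigcapT_measurable => n; have [] := hB n.
- by move=> x Xx n _; have [_ XB _] := hB n; exact: XB.
- apply/lee_addgt0Pr => e e0; near \oo => n; have [_ _ hBn] := hB n.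
  apply: (@le_trans _ _ (stieltjes_outer g (B n))).
    by apply: le_outer_measure; exact: bigcap_inf.
  rewrite (le_trans hBn)// leeD2l// lee_fin ltW//.
  by near: n; apply: (near_infty_natSinv_lt (PosNum e0)).
Unshelve. all: by end_near. Qed.

(** Each piece of [A] in a bounded interval has finite measure, so its hull exceeds it by a null
    set, by subtraction. A second hull encloses this difference in a Borel null set. *)
Lemma caratheodory_ae_borel (A : set R) :
  (stieltjes_outer g).-cara.-measurable A ->
  exists B N : set R, [/\ measurable B, measurable N, stieltjes_borel N = 0 &
    forall x, ~ N x -> A x <-> B x].
Proof.
move=> cA; pose I n : set R := `[(- n%:R)%R, n%:R[%classic.
have h n : exists BN : set R * set R, [/\ measurable BN.1, measurable BN.2,
    stieltjes_borel BN.2 = 0 & forall x, ~ BN.2 x -> (A `&` I n) x <-> BN.1 x].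
  have cAI : (stieltjes_outer g).-cara.-measurable (A `&` I n).
    by apply: measurableI => //; apply: borel_caratheodory; exact: measurable_itv.
  have [H [mH AH HA]] := borel_hull (A `&` I n).
  have AIoo : stieltjes g (A `&` I n) < +oo.
    apply: (@le_lt_trans _ _ (stieltjes g (I n))).
      by apply: le_outer_measure; exact: subIsetr.
    by rewrite stieltjes_itv ?ltry// (@le_trans _ _ 0%R)// lerNl oppr0.
  have [N [mN HN N0]] := borel_hull (H `\` (A `&` I n)).
  exists (H, N); split => //=.
    apply/eqP; rewrite eq_le measure_ge0 andbT; apply: le_trans N0 _.
    have := @measureD _ _ R (stieltjes g) H (A `&` I n) (borel_caratheodory mH) cAI.
    rewrite (setIidr AH) => /(_ (le_lt_trans HA AIoo)) HE.
    by rewrite [leLHS]HE sube_le0.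
  move=> x Nx; split => [/AH//|Hx]; apply: contrapT => Ax; apply: Nx.
  exact: HN.
have [BN hBN] := choice h.
exists (\bigcup_n (BN n).1), (\bigcup_n (BN n).2); split.
- by apply: bigcupT_measurable => n; have [] := hBN n.
- by apply: bigcupT_measurable => n; have [] := hBN n.
- apply/eqP; rewrite eq_le measure_ge0 andbT.
  apply: le_trans (outer_measure_sigma_subadditive (stieltjes_outer g) _) _.
  by rewrite eseries0// => n _ _; have [] := hBN n.
- move=> x Nx.
  have hx n : (A `&` I n) x <-> (BN n).1 x.
    by have [_ _ _] := hBN n; apply => NBx; apply: Nx; exists n.
  split => [Ax|[n _ /hx[]//]].
  exists (Num.bound x) => //; apply/hx; split => //.
  by rewrite /I/= in_itv/= ltr_bound lerNl ltW// ltrNbound.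
Qed.

(** Only the countably many superlevel sets at rational heights are replaced by Borel sets, so the
    exceptional sets have a null union; any other superlevel set is a union of these. *)
Lemma measurable_fun_ae_borel (u : caratheodory_type (stieltjes_outer g) -> R) :
  measurable_fun setT u ->
  exists N : set R, [/\ measurable N, stieltjes_borel N = 0 &
    measurable_fun (~` N) (u : R -> R)].
Proof.
move=> mu.
(* An enumeration of the rationals; an integer that codes none is sent to 0, which merely repeats a
   value. *)
pose r n : R := ratr (odflt 0%R (@unpickle rat n)).
have h n : exists BN : set R * set R, [/\ measurable BN.1, measurable BN.2,
    stieltjes_borel BN.2 = 0 & forall x, ~ BN.2 x -> (r n < u x)%R <-> BN.1 x].
  have /caratheodory_ae_borel[B [N [? ? ? BN]]] :
      (stieltjes_outer g).-cara.-measurable (u @^-1` `]r n, +oo[).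
    by rewrite -[X in _ X]setTI; apply: mu => //; exact: measurable_itv.
  exists (B, N); split => // x Nx; by move: (BN x Nx) => /=; rewrite in_itv/= andbT.
have [BN hBN] := choice h.
exists (\bigcup_n (BN n).2); split.
- by apply: bigcupT_measurable => n; have [] := hBN n.
- apply/eqP; rewrite eq_le measure_ge0 andbT.
  apply: le_trans (outer_measure_sigma_subadditive (stieltjes_outer g) _) _.
  by rewrite eseries0// => n _ _; have [] := hBN n.
- apply: (measurability _ (RGenOInfty.measurableE R)).
  move=> _ [_ [y ->] <-].
  rewrite (_ : _ `&` _ = ~` (\bigcup_n (BN n).2) `&`
      \bigcup_n (if (y < r n)%R then (BN n).1 else set0)); last first.
    apply/seteqP; split => x [Nx] /=; have ux n : (r n < u x)%R <-> (BN n).1 x.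
    - by have [_ _ _] := hBN n; apply => ?; apply: Nx; exists n.
    - rewrite in_itv/= andbT => /rat_in_itvoo[q]; rewrite in_itv/= => /andP[yq qu].
      have rq : r (pickle q) = ratr q by rewrite /r pickleK.
      by split => //; exists (pickle q) => //; rewrite rq yq; apply/ux; rewrite rq.
    - by have [_ _ _] := hBN n; apply => ?; apply: Nx; exists n.
    - move=> [n _]; case: ifPn => // yrn /ux rnu; split => //.
      by rewrite in_itv/= andbT (lt_trans yrn).
  apply: measurableI.
    by apply: measurableC; apply: bigcupT_measurable => n; have [] := hBN n.
  apply: bigcupT_measurable => n; case: ifP => // _.
  by have [] := hBN n.
Qed.

End stieltjes_borel.

(** * Jump and continuous parts *)

Lemma measureU_eq0 d (T : measurableType d) (R : realType)
    (mu : {measure set T -> \bar R}) (A B : set T) : measurable A -> measurable B ->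
  mu A = 0%E -> mu B = 0%E -> mu (A `|` B) = 0%E.
Proof. by move=> mA mB A0 B0; rewrite measureU0. Qed.

(** * Translation invariance of Lebesgue measure *)

Section translation.
Context {R : realType}.
Implicit Type h : R.

Lemma measurable_addr h : measurable_fun setT (fun x : R => x + h).
Proof. exact: measurable_funD. Qed.

Lemma lebesgue_measure_shift h (A : set R) : measurable A ->
  lebesgue_measure ((fun x => x + h) @^-1` A) = lebesgue_measure A.
Proof.
move=> mA; have mh : measurable_fun setT (fun x : measurableTypeR R => (x + h : measurableTypeR R)).
  exact: measurable_addr.
suff : lebesgue_measure A = pushforward lebesgue_measure
    (fun x : measurableTypeR R => (x + h : measurableTypeR R)) A.
  by move=> ->.
apply: lebesgue_measure_unique => //= _ [[a b] _ <-].
rewrite /pushforward (_ : _ @^-1` _ = `]a - h, b - h]%classic); last first.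
  by apply/seteqP; split=> x /=; rewrite !in_itv/= ltrBlDr lerBrDr.
rewrite !lebesgue_measure_itv/= !lte_fin ltrD2r; case: ifP => // _.
by rewrite -!EFinB; congr EFin; ring.
Qed.

Lemma integral_shift h (D : set R) (f : R -> \bar R) : measurable D ->
  measurable_fun setT f -> (forall x, 0 <= f x)%E ->
  (\int[lebesgue_measure]_(x in (fun x => x + h)%R @^-1` D) f (x + h)%R =
   \int[lebesgue_measure]_(x in D) f x)%E.
Proof.
move=> mD mf f0.
have mh : measurable_fun setT (fun x : measurableTypeR R => (x + h : measurableTypeR R)).
  exact: measurable_addr.
have := @ge0_integral_pushforward _ _ _ _ R _ mh lebesgue_measure D f mD.
move=> <- //; last exact: measurable_funTS.
by apply: eq_measure_integral => A mA _; rewrite [LHS]lebesgue_measure_shift.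
Qed.

End translation.

Section scalar_ae_borel.
Context {R : realType} {k : scalar_kind}.
Variable g : derivator R.

Lemma scalar_ae_borel (f : caratheodory_type (stieltjes_outer g) -> borel R k) :
  measurable_fun setT f ->
  exists N : set R, [/\ measurable N, stieltjes_borel g N = 0%E &
    scalar_measurable (patch (fun=> 0) (~` N) (f : R -> scalar_field R k))].
Proof.
move=> /borel_scalar_measurable[mr mi].
have [N1 [mN1 N10 mrN]] := measurable_fun_ae_borel mr.
have [N2 [mN2 N20 miN]] := measurable_fun_ae_borel mi.
have mN : measurable (N1 `|` N2) by exact: measurableU.
exists (N1 `|` N2); split => //.
  exact: measureU_eq0.
(* Both components vanish at 0, so they commute with the extension by zero. *)
have mp (u : scalar_field R k -> R) : u 0 = 0 ->
    measurable_fun (~` (N1 `|` N2)) (u \o (f : R -> scalar_field R k)) ->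
    measurable_fun setT (u \o patch (fun=> 0) (~` (N1 `|` N2)) (f : R -> scalar_field R k)).
  move=> u0 muf; rewrite (_ : _ \o _ = (u \o (f : R -> scalar_field R k)) \_ (~` (N1 `|` N2))).
    by apply/(measurable_restrictT _ _).1 => //; exact: measurableC.
  by apply/funext => x /=; rewrite !patchE; case: ifP.
split; apply: mp; rewrite ?scalar_re0 ?scalar_im0//.
  apply: measurable_funS mrN; first exact: measurableC.
  by apply: subsetC; exact: subsetUl.
apply: measurable_funS miN; first exact: measurableC.
by apply: subsetC; exact: subsetUr.
Qed.

End scalar_ae_borel.

Lemma ge0_integral_mrestr d (T : measurableType d) (R : realType)
    (mu : {measure set T -> \bar R}) (E : set T) (mE : measurable E) (f : T -> \bar R) :
  measurable_fun setT f -> (forall x, 0 <= f x)%E ->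
  (\int[mrestr mu mE]_x f x = \int[mu]_(x in E) f x)%E.
Proof.
move=> mf f0.
rewrite (@ge0_negligible_integral _ _ _ _ setT (~` E))//; last first.
- by rewrite /= /mrestr setICl measure0.
- exact: measurableC.
rewrite setDE setTI setCK; apply: eq_measure_integral => A mA AE.
by rewrite /= /mrestr setIidl.
Qed.

(** * Atoms and increments *)

Section jumps.
Context {R : realType}.
Variable g : derivator R.
Local Notation mu := (stieltjes_borel g).

(** The [lim] in [jump] is informative only if the limit exists; monotonicity provides it. *)
Lemma derivator_right_limit (t : R) :
  derivator_fun g x @[x --> t^'+] --> g t + jump g t.
Proof.
rewrite /jump addrC subrK.
apply: nondecreasing_at_right_is_cvgr.
  by near=> b => x y _ _; exact: derivator_nondecreasing.
near=> b; exists (g t) => _ [x /= + <-]; rewrite in_itv/= => /andP[tx _].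
by apply: derivator_nondecreasing; exact: ltW.
Unshelve. all: by end_near.
Qed.

(** Continuity from above along the intervals from [t] to t + 1/(n+1), closed on the left. *)
Lemma stieltjes_borel_set1 (t : R) : mu [set t] = (jump g t)%:E.
Proof.
pose F n : set R := `[t, t + n.+1%:R^-1[%classic.
have FE : [set t] = \bigcap_n F n.
  apply/seteqP; split => [_ -> n _|x Fx] /=.
    by rewrite /F/= in_itv/= lexx/= ltrDl.
  have := Fx 0%N Logic.I; rewrite /F/= in_itv/= => /andP[tx _].
  apply/eqP; rewrite eq_le tx andbT; apply/ler_addgt0Pr => e e0.
  near \oo => n; have := Fx n Logic.I; rewrite /F/= in_itv/= => /andP[_ /ltW xn].
  rewrite (le_trans xn)// lerD2l ltW//.
  by near: n; apply: (near_infty_natSinv_lt (PosNum e0)).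
have muF n : mu (F n) = (g (t + n.+1%:R^-1) - g t)%:E.
  by rewrite stieltjes_borel_itv// lerDl.
have : mu \o F @ \oo --> mu (\bigcap_n F n).
  apply: nonincreasing_cvg_mu.
  - by rewrite [ltLHS]muF ltry.
  - by move=> i; exact: measurable_itv.
  - by rewrite -FE; exact: measurable_set1.
  - move=> m n mn; apply/subsetPset => x; rewrite /F/= !in_itv/=.
    move=> /andP[-> xn]; apply: (lt_le_trans xn).
    by rewrite lerD2l lef_pV2 ?posrE// ler_nat.
rewrite -FE => h1.
have h2 : mu \o F @ \oo --> (jump g t)%:E.
  rewrite (_ : mu \o F = EFin \o (fun n => g (t + n.+1%:R^-1) - g t)); last first.
    by apply/funext => n /=; rewrite muF.
  apply: cvg_EFin; first by near=> n.
  rewrite (_ : _ \o _ = (fun n => g (t + n.+1%:R^-1) - g t))//.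
  rewrite -[X in _ --> X](addrK (g t)) [X in _ --> X - _]addrC.
  apply: cvgB; last exact: cvg_cst.
  move/cvg_at_rightP : (@derivator_right_limit t); apply; split.
    by move=> n; rewrite ltrDl invr_gt0.
  rewrite -[X in _ --> X]addr0; apply: cvgD; first exact: cvg_cst.
  exact: cvg_harmonic.
exact: cvg_unique h1 h2.
Unshelve. all: by end_near. Qed.

Lemma jump_ge0 (t : R) : 0 <= jump g t.
Proof. by rewrite -lee_fin -stieltjes_borel_set1 measure_ge0. Qed.

Lemma stieltjes_borel_itv_fin (x y : R) (A : set R) : measurable A ->
  (mu (`[x, y[%classic `&` A) \is a fin_num).
Proof.
move=> mA; rewrite ge0_fin_numE//.
apply: (@le_lt_trans _ _ (mu `[x, y[%classic)).
  by apply: le_measure; rewrite ?inE//; exact: measurableI.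
have [xy|yx] := leP x y; first by rewrite stieltjes_borel_itv ?ltry.
by rewrite set_itv_ge ?measure0 ?ltry// -leNgt bnd_simp ltW.
Qed.

Variables (I : set nat) (d : nat -> R).
Hypothesis dE : set_bij I (jump_set g) d.

Lemma jump_setE : jump_set g = \bigcup_(i in I) [set d i].
Proof.
have [dI dinj dsurj] := dE; apply/seteqP; split => [x /dsurj[i Ii <-]|x [i Ii ->]].
  by exists i.
exact: dI.
Qed.

Lemma measurable_jump_set : measurable (jump_set g).
Proof.
rewrite jump_setE bigcup_mkcond; apply: bigcupT_measurable => i.
by case: ifP => // _; exact: measurable_set1.
Qed.

(** Turns the sums in [jump_part] into measures, so that increments are computed by additivity. *)
Lemma esum_jumpE (A : set R) : measurable A ->
  (\esum_(s in A `&` jump_set g) (jump g s)%:E = mu (A `&` jump_set g))%E.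
Proof.
move=> mA; have [dI dinj dsurj] := dE.
have bij : set_bij (I `&` d @^-1` A) (A `&` jump_set g) d.
  split.
  - by move=> i [Ii Ai]; split => //; exact: dI.
  - by move=> i j /set_mem[Ii _] /set_mem[Ij _]; apply: dinj; rewrite inE.
  - by move=> x [Ax /dsurj[i Ii ix]]; exists i => //; split => //=; rewrite ix.
rewrite (reindex_esum _ _ _ _ bij)//.
rewrite (_ : A `&` jump_set g = \bigcup_(i in I `&` d @^-1` A) [set d i]); last first.
  apply/seteqP; split => [x [Ax /dsurj[i Ii ix]]|x [i [Ii Ai] ->]].
    by exists i => //; split => //=; rewrite ix.
  by split => //; exact: dI.
rewrite measure_bigcup; last 2 first.
- by move=> i _; exact: measurable_set1.
- by move=> i j [Ii _] [Ij _] [x [/= -> ]]; apply: dinj; rewrite inE.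
rewrite nneseries_esum => [|i _]; last exact: measure_ge0.
by rewrite set_mem_set; apply: eq_esum => i _; rewrite -stieltjes_borel_set1.
Qed.

Let mD := measurable_jump_set.

(** Both branches of [jump_part] are signed masses counted from 0, so the increment telescopes
    wherever 0 lies with respect to [x] and [y]. *)
Lemma jump_partB (x y : R) : x <= y ->
  jump_part g y - jump_part g x = fine (mu (`[x, y[%classic `&` jump_set g)).
Proof.
move=> xy; rewrite /jump_part !esum_jumpE//.
have split3 (a b c : R) : a <= b -> b <= c ->
    fine (mu (`[a, c[%classic `&` jump_set g)) =
    fine (mu (`[a, b[%classic `&` jump_set g)) + fine (mu (`[b, c[%classic `&` jump_set g)).
  move=> ab bc; rewrite -fineD ?stieltjes_borel_itv_fin// -measureU//.
  - by rewrite -setIUl -itv_bndbnd_setU// bnd_simp.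
  - exact: measurableI.
  - exact: measurableI.
  - rewrite setIACA setIid; apply/seteqP; split => // z [[]] /=; rewrite !in_itv/=.
    by move=> /andP[_ zb] /andP[bz _] _; move: (lt_le_trans zb bz); rewrite ltxx.
have [y0|y0] := ltP 0 y; have [x0|x0] := ltP 0 x.
- by rewrite (split3 0 x y)// ?(ltW x0)// addrC addKr.
- by rewrite opprK addrC -split3// ltW.
- by move: (lt_le_trans x0 xy); rewrite ltNge y0.
- by rewrite opprK addrC (split3 x y 0)// addrK.
Qed.

Lemma cont_partB (x y : R) : x <= y ->
  cont_part g y - cont_part g x = fine (mu (`[x, y[%classic `\` jump_set g)).
Proof.
move=> xy; have -> : cont_part g y - cont_part g x =
    (g y - g x) - (jump_part g y - jump_part g x) by rewrite /cont_part; ring.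
rewrite jump_partB//; apply/eqP; rewrite subr_eq -fineD; last 2 first.
- by rewrite setDE stieltjes_borel_itv_fin//; exact: measurableC.
- by rewrite stieltjes_borel_itv_fin.
rewrite -measureU; [| |exact: measurableI|]; last 2 first.
- exact: measurableD.
- by rewrite setDE setIACA setICl setI0.
by rewrite setUC setUIDK [X in fine X](stieltjes_borel_itv g xy).
Qed.

Lemma cont_part_nondecreasing : {homo cont_part g : x y / x <= y}.
Proof. by move=> x y xy; rewrite -subr_ge0 cont_partB// fine_ge0. Qed.

Lemma cont_partB_le (x y : R) : x <= y ->
  cont_part g y - cont_part g x <= g y - g x.
Proof.
move=> xy; rewrite cont_partB// -lee_fin fineK; last first.
  by rewrite setDE stieltjes_borel_itv_fin//; exact: measurableC.
rewrite -(stieltjes_borel_itv g xy); apply: le_measure; rewrite ?inE//.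
exact: measurableD.
Qed.

(** For continuity from the right, the bound [g y - g x] of [cont_partB_le] is too large by the atom
    at [x]. The increment of the continuous part does not see this atom: it is at most the mass of
    the open interval. *)
Lemma cont_partB_le_right (x y : R) : x < y ->
  cont_part g y - cont_part g x <= g y - (g x + jump g x).
Proof.
move=> xy; rewrite cont_partB ?(ltW xy)// -lee_fin fineK; last first.
  by rewrite setDE stieltjes_borel_itv_fin//; exact: measurableC.
rewrite opprD addrA EFinB -(stieltjes_borel_itv g (ltW xy)) -stieltjes_borel_set1.
have itvE : `[x, y[%classic = [set x] `|` `]x, y[%classic :> set R.
  by rewrite (@setU1itv _ _ (BLeft y) x false)// bnd_simp.
have -> : (mu `[x, y[%classic - mu [set x] = mu `]x, y[%classic)%E.
  rewrite itvE measureU//=.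
  - by rewrite addeAC subee ?add0e// stieltjes_borel_set1.
  - by apply/seteqP; split => // z [->]/=; rewrite in_itv/= ltxx.
apply: (@le_trans _ _ (mu (`]x, y[%classic `|` ([set x] `\` jump_set g)))).
  apply: le_measure; rewrite ?inE.
  - exact: measurableD.
  - by apply: measurableU => //; exact: measurableD.
  - by rewrite itvE => z [[->|xz] Dz]; [right|left].
rewrite (le_trans (measureU2 _ _ _))//=; first exact: measurableD.
rewrite [X in (_ + X)%E](_ : _ = 0)%E ?adde0//.
(* Either [x] is a jump and has been removed, or its mass [jump g x] is not positive. *)
have [Dx|Dx] := pselect (jump_set g x).
  rewrite (_ : _ `\` _ = set0) ?measure0//.
  by apply/seteqP; split => // z [-> ].
apply/eqP; rewrite eq_le measure_ge0 andbT.
apply: (@le_trans _ _ (mu [set x])).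
  by apply: le_measure; rewrite ?inE//; exact: measurableD.
by rewrite stieltjes_borel_set1 lee_fin leNgt; apply/negP.
Qed.

Lemma cont_part_continuous : continuous (cont_part g).
Proof.
move=> t; apply/left_right_continuousP; split.
  apply/cvgrPdist_le => e e0.
  have := derivator_left_continuous (d := g) (t := t).
  move=> /cvgrPdist_le/(_ _ e0); apply: filter_app; near=> x => gtx.
  have xt : x <= t by near: x; exact: nbhs_left_le.
  rewrite ger0_norm ?subr_ge0 ?cont_part_nondecreasing//.
  by rewrite (le_trans (cont_partB_le xt))// (le_trans (ler_norm _)).
apply/cvgrPdist_le => e e0.
have := @derivator_right_limit t.
move=> /cvgrPdist_le/(_ _ e0); apply: filter_app; near=> x => gtx.
have tx : t < x by near: x; exact: nbhs_right_gt.
rewrite distrC ger0_norm ?subr_ge0 ?cont_part_nondecreasing ?(ltW tx)//.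
by rewrite (le_trans (cont_partB_le_right tx))// (le_trans (ler_norm _))// distrC.
Unshelve. all: by end_near. Qed.

(** * The pseudoinverse and the decomposition of the measure *)

Hypothesis nconst : forall t, ~ exists c, forall s, s <= t -> cont_part g s = c.

(** By [nconst], some point to the left of the fibre has another value, and by monotonicity it
    bounds the fibre from below. Continuity puts the infimum in the fibre. *)
Lemma pseudoinverseP (z : R) : range (cont_part g) z ->
  cont_part g (pseudoinverse g z) = z /\
  forall s, cont_part g s = z -> pseudoinverse g z <= s.
Proof.
move=> [t0 _ t0z]; rewrite /pseudoinverse; case: xgetP => [x _ //|nomin].
pose S := [set t | cont_part g t = z].
have S0 : S !=set0 by exists t0.
have [a aS] : exists a, lbound S a.
  have [s [st0 /eqP sz]] : exists s, s <= t0 /\ cont_part g s <> z.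
    apply: contrapT => h; apply: (nconst (t := t0)); exists z => s st0.
    by apply: contrapT => sz; apply: h; exists s.
  exists s => t /= tz; rewrite leNgt; apply/negP => ts.
  move/eqP : sz; apply; apply/eqP; rewrite eq_le -{2}tz -t0z.
  by rewrite !cont_part_nondecreasing// ltW.
have hinf : has_inf S by split => //; exists a.
have Sinf : S (inf S).
  apply/eqP; rewrite /= eq_le; apply/andP; split.
    by rewrite -t0z cont_part_nondecreasing//; apply: ge_inf => //; exists a.
  rewrite leNgt; apply/negP => infz.
  have : \forall x \near inf S, cont_part g x < z.
    exact: (cvgr_lt _ (@cont_part_continuous (inf S))).
  move=> /nbhs_ballP[e /= e0 he].
  have [s Ss sinf] := inf_adherent e0 hinf.
  have /he : ball (inf S) e s.
    rewrite /ball/= distrC ger0_norm ?subr_ge0; first by rewrite ltrBlDl.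
    by apply: ge_inf => //; exists a.
  by rewrite Ss ltxx.
exfalso; apply: (nomin (inf S)); split => // s sz.
by apply: ge_inf => //; exists a.
Qed.

(** A Galois connection: preimages of rays under the pseudoinverse are rays of the range. *)
Lemma pseudoinverse_le (z t : R) : range (cont_part g) z ->
  (pseudoinverse g z <= t) = (z <= cont_part g t).
Proof.
move=> rz; have [gz mz] := pseudoinverseP rz; apply/idP/idP => [zt|zt].
  by rewrite -{1}gz cont_part_nondecreasing.
rewrite leNgt; apply/negP => tz.
have /mz : cont_part g t = z.
  by apply/eqP; rewrite eq_le zt andbT -[leRHS]gz cont_part_nondecreasing// ltW.
by rewrite leNgt tz.
Qed.

Lemma range_cont_part_itv : is_interval (range (cont_part g)).
Proof.
move=> _ _ [s _ <-] [t _ <-] z /andP[sz zt].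
have [st|/ltW/cont_part_nondecreasing ts] := leP s t; last first.
  by exists s => //; apply/eqP; rewrite eq_le sz (le_trans zt).
have cw : {within `[s, t], continuous (cont_part g)}.
  exact/continuous_subspaceT/cont_part_continuous.
have [|c _ <-] := @IVT _ _ _ _ z st cw; last by exists c.
by rewrite ge_min le_max sz zt orbT.
Qed.

Lemma measurable_range_cont_part : measurable (range (cont_part g)).
Proof. by apply: is_interval_measurable; exact: range_cont_part_itv. Qed.

Lemma pseudoinverse_out (z : R) : ~ range (cont_part g) z -> pseudoinverse g z = 0.
Proof.
by move=> rz; rewrite /pseudoinverse; case: xgetP => [x _ [gx _]|//]; case: rz; exists x.
Qed.

Lemma measurable_pseudoinverse : measurable_fun setT (pseudoinverse g).
Proof.
have mr := measurable_range_cont_part.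
rewrite -(setUv (range (cont_part g))); apply/measurable_funU => //.
  exact: measurableC.
split; last first.
  have : measurable_fun (~` range (cont_part g)) (cst 0 : R -> R) by [].
  by apply: eq_measurable_fun => z; rewrite inE => /pseudoinverse_out ->.
apply: (measurability _ (RGenOInfty.measurableE R)).
move=> _ [_ [y ->] <-].
rewrite (_ : _ `&` _ = range (cont_part g) `&` `]cont_part g y, +oo[%classic).
  exact: measurableI.
apply/seteqP; split => z [rz] /=; rewrite !in_itv/= !andbT => h; split => //; move: h.
  by rewrite !ltNge pseudoinverse_le.
by rewrite !ltNge pseudoinverse_le.
Qed.

(** The set lies between the open and the closed interval with ends [cont_part g x] and
    [cont_part g y]. *)
Lemma lebesgue_pseudoinverse_itv (x y : R) : x <= y ->
  lebesgue_measure (range (cont_part g) `&` pseudoinverse g @^-1` `[x, y[) =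
  (cont_part g y - cont_part g x)%:E.
Proof.
move=> xy; have gxy := cont_part_nondecreasing xy.
apply/eqP; rewrite eq_le; apply/andP; split.
  apply: (@le_trans _ _ (lebesgue_measure `[cont_part g x, cont_part g y]%classic)).
    apply: le_measure; rewrite ?inE//.
      apply: measurableI; first exact: measurable_range_cont_part.
      rewrite -[X in measurable X]setTI.
      by apply: measurable_pseudoinverse => //; exact: measurable_itv.
    move=> z [rz] /=; rewrite !in_itv/= => /andP[xz /ltW zy].
    have [gz _] := pseudoinverseP rz.
    by rewrite -pseudoinverse_le// zy andbT -gz cont_part_nondecreasing.
  by rewrite lebesgue_measure_itv/= lte_fin; case: ltP => // _; rewrite lee_fin subr_ge0.
apply: (@le_trans _ _ (lebesgue_measure `]cont_part g x, cont_part g y[%classic)).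
  rewrite lebesgue_measure_itv/= lte_fin; case: ltP => // ggyx.
  by rewrite lee_fin subr_le0.
apply: le_measure; rewrite ?inE//.
  apply: measurableI; first exact: measurable_range_cont_part.
  rewrite -[X in measurable X]setTI.
  by apply: measurable_pseudoinverse => //; exact: measurable_itv.
move=> z /=; rewrite !in_itv/= => /andP[xz zy].
have rz : range (cont_part g) z.
  apply: (range_cont_part_itv (imageT _ x) (imageT _ y)).
  by rewrite (ltW xz) (ltW zy).
split; first exact: rz.
rewrite leNgt; apply/andP; split.
  apply/negP => /ltW; rewrite pseudoinverse_le// => zx.
  by move: (lt_le_trans xz zx); rewrite ltxx.
rewrite ltNge; apply/negP => yz; have [gz _] := pseudoinverseP rz.
by move: zy; rewrite -gz ltNge cont_part_nondecreasing.
Qed.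

(** The right-hand side is a Borel measure in [A]. On an interval its terms are the increments of
    [jump_part g] and [cont_part g], which add up to that of [g], and intervals determine the
    measure. *)
Lemma stieltjes_borelE (A : set R) : measurable A ->
  mu A = (mu (A `&` jump_set g) +
    lebesgue_measure (range (cont_part g) `&` pseudoinverse g @^-1` A))%E.
Proof.
move=> mA; pose m1 := mrestr mu mD.
pose m2 := pushforward (mrestr lebesgue_measure measurable_range_cont_part)
  (pseudoinverse g).
have mpi := measurable_pseudoinverse.
have m12 (B : set R) : (m1 B + m2 B = mu (B `&` jump_set g) +
    lebesgue_measure (range (cont_part g) `&` pseudoinverse g @^-1` B))%E.
  by rewrite /m1 /m2 /mrestr /pushforward setIC (setIC (_ @^-1` _)) (setIC _ B).
rewrite -m12 -measure_addE; apply: measure_eq_stieltjes_borel => // x y xy.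
rewrite [LHS]measure_addE [LHS]m12 lebesgue_pseudoinverse_itv//.
rewrite -[X in (X + _)%E]fineK; last first.
  by apply: stieltjes_borel_itv_fin; exact: mD.
rewrite -jump_partB// -EFinD /cont_part; congr EFin; ring.
Qed.

Lemma integral_stieltjes_split (f : R -> \bar R) :
  measurable_fun setT f -> (forall x, 0 <= f x)%E ->
  (\int[mu]_x f x = \esum_(i in I) (f (d i) * (jump g (d i))%:E) +
    \int[lebesgue_measure]_(x in range (cont_part g)) f (pseudoinverse g x))%E.
Proof.
move=> mf f0; have mpi := measurable_pseudoinverse.
have mrange := measurable_range_cont_part.
rewrite -{1}(setUv (jump_set g)) ge0_integral_setU//; last 3 first.
- exact: measurableC.
- by rewrite setUv.
- by rewrite disj_set2E setICr.
congr (_ + _)%E.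
  rewrite {1}jump_setE bigcup_mkcond ge0_integral_bigcup//; last 3 first.
  - by move=> i; case: ifP.
  - exact: measurable_funTS.
  - move=> i j _ _; case: ifPn => [/set_mem Ii|]; last by rewrite set0I => _ [].
    case: ifPn => [/set_mem Ij|]; last by rewrite setI0 => _ [].
    by move=> [x [/= ->]]; have [_ dinj _] := dE; apply: dinj; rewrite inE.
  rewrite -[in RHS](set_mem_set I) -nneseries_esum; last first.
    by move=> i _; rewrite mule_ge0// lee_fin jump_ge0.
  rewrite [RHS]eseries_mkcond; apply: eq_eseriesr => i _; case: ifPn => Ii; last first.
    by rewrite integral_set0.
  rewrite (eq_integral (cst (f (d i)))); last by move=> x /set_mem ->.
  by rewrite integral_cst// -stieltjes_borel_set1.
pose m2 := pushforward (mrestr lebesgue_measure mrange) (pseudoinverse g).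
transitivity (\int[m2]_(x in ~` jump_set g) f x)%E.
  apply: eq_measure_integral => A mA AD; rewrite [LHS]stieltjes_borelE//.
  rewrite (_ : A `&` _ = set0) ?measure0 ?add0e; last exact/disjoints_subset.
  by rewrite /= /m2 /pushforward /mrestr setIC.
rewrite ge0_integral_pushforward//; last 2 first.
- exact: measurableC.
- exact: measurable_funTS.
rewrite -(ge0_integral_mrestr lebesgue_measure mrange); last 2 first.
- exact: measurableT_comp.
- by move=> x.
(* On the range, [cont_part g] undoes [pseudoinverse g], so the points sent to jumps are among the
   countably many [cont_part g (d i)]. *)
rewrite [RHS](@ge0_negligible_integral _ _ R (mrestr lebesgue_measure mrange)
  setT (pseudoinverse g @^-1` jump_set g))//; last 3 first.
- by rewrite -[X in measurable X]setTI; exact: mpi.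
- exact: measurableT_comp.
- rewrite [LHS](@countable_lebesgue_measure0 R)//.
  apply: (@sub_countable _ _ _ (\bigcup_(i in I) [set cont_part g (d i)])).
    apply: subset_card_le => z [Dz rz]; have [gz _] := pseudoinverseP rz.
    by have [_ _ /(_ _ Dz)[i Ii diz]] := dE; exists i => //=; rewrite diz gz.
  exact: bigcup_countable.
by congr integral; rewrite setTD preimage_setC.
Qed.

End jumps.

(** * Integrals for completed Lebesgue measure *)

Section completed_integral.
Context {R : realType}.
Local Open Scope ereal_scope.

Lemma borel_sub_completed (A : set R) : measurable A ->
  (@wlength R idfun)^*%mu.-cara.-measurable A.
Proof. exact: sub_caratheodory. Qed.

(** Completeness makes [f] measurable, as it agrees with a Borel function off a null set. The
    integral of that Borel function passes to the Borel sets because Lebesgue measure is the image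
    of its completion under the identity. *)
Lemma integral_completed_ae (D M : set R) (f f' : R -> \bar R) :
  measurable D -> measurable M -> lebesgue_measure M = 0 ->
  measurable_fun setT f' -> (forall x, 0 <= f x) -> (forall x, 0 <= f' x) ->
  (forall x, ~ M x -> f x = f' x) ->
  \int[completed_lebesgue_measure]_(x in D) f x = \int[lebesgue_measure]_(x in D) f' x.
Proof.
move=> mD mM M0 mf' f0 f'0 ff'.
have cmD := borel_sub_completed mD.
pose T : measurableType _ := caratheodory_type (@wlength R idfun)^*%mu.
have mid : measurable_fun setT (id : T -> measurableTypeR R).
  by move=> _ A mA; rewrite setTI; exact: borel_sub_completed.
have cmf'T : measurable_fun setT (f' : T -> \bar R) by exact: (measurableT_comp mf' mid).
have cmf' : measurable_fun (D : set T) (f' : T -> \bar R) by exact: measurable_funTS.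
have ae : ae_eq (@completed_lebesgue_measure R) D f' f.
  exists M; split; [exact: borel_sub_completed|exact: M0|].
  move=> x /= h; apply: contrapT => Mx; apply: h => _; exact/esym/ff'.
have cmf := ae_measurable_fun (@completed_lebesgue_measure_is_complete R) ae cmf'.
rewrite -(ge0_ae_eq_integral cmD cmf' cmf _ _ ae)//.
have := @ge0_integral_pushforward _ _ _ _ R _ mid completed_lebesgue_measure D f' mD.
by rewrite preimage_id => <- //; exact: measurable_funTS.
Qed.

End completed_integral.

(** * Borel versions of classes *)

Section class_borel.
Context {R : realType} {k : scalar_kind}.
Variables (g : derivator R) (I : set nat) (d : nat -> R).
Hypothesis dE : set_bij I (jump_set g) d.
Hypothesis nconst : forall t, ~ exists c, forall s, s <= t -> cont_part g s = c.
Local Notation mu := (stieltjes_borel g).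

(** The exceptional set is Borel, so that its preimage under the pseudoinverse is Borel too and
    [stieltjes_borelE] applies to it. *)
Definition borel_version (f F : R -> scalar_field R k) :=
  scalar_measurable F /\
  exists N : set R, [/\ measurable N, mu N = 0%E & forall x, ~ N x -> f x = F x].

Lemma borel_version_ex (f : mfun_class k g) : exists F, borel_version (class_fun f) F.
Proof.
have mf : measurable_fun setT
    (class_fun f : caratheodory_type (stieltjes_outer g) -> borel R k).
  by rewrite /class_fun /aqEqMfun_to_fun; exact: measurable_funP.
have [N [mN N0 mp]] := scalar_ae_borel mf.
exists (patch (fun=> 0) (~` N) (class_fun f)); split => //; exists N; split => // x Nx.
by rewrite patchE mem_set.
Qed.

Lemma borel_version0 : borel_version (fun=> 0) (fun=> 0).
Proof.
split; first exact: scalar_measurable_cst.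
by exists set0; split => //; exact: measure0.
Qed.

(** A point of positive mass lies in no null set. *)
Lemma borel_version_jump (f F : R -> scalar_field R k) i :
  borel_version f F -> I i -> f (d i) = F (d i).
Proof.
move=> [_ [N [mN N0 fF]]] Ii; apply: fF => Ni.
have [dI _ _] := dE; have : (mu [set d i] <= mu N)%E.
  by apply: le_measure; rewrite ?inE// => _ ->.
rewrite N0 stieltjes_borel_set1 lee_fin leNgt.
by have := dI i Ii; rewrite /jump_set/= => ->.
Qed.

Lemma scalar_measurable_pseudoinverse (F : R -> scalar_field R k) :
  scalar_measurable F -> scalar_measurable (comp_pseudoinverse g F).
Proof.
move=> mF.
have [mr mi] := scalar_measurable_comp mF (measurable_pseudoinverse dE nconst).
have mp (u : scalar_field R k -> R) : u 0 = 0 ->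
    measurable_fun setT (u \o (F \o pseudoinverse g)) ->
    measurable_fun setT (u \o comp_pseudoinverse g F).
  move=> u0 muF.
  rewrite (_ : _ \o _ = (u \o (F \o pseudoinverse g)) \_ (range (cont_part g))).
    apply/(measurable_restrictT _ _).1; last exact: measurable_funTS.
    exact: measurable_range_cont_part dE.
  by apply/funext => x /=; rewrite /comp_pseudoinverse !patchE; case: ifP.
by split; apply: mp => //; [exact: scalar_re0|exact: scalar_im0].
Qed.

(** By [stieltjes_borelE], the Lebesgue measure of the part of the range sent into [N] is a summand
    of the measure of [N], which is zero. *)
Lemma comp_pseudoinverse_version (f F : R -> scalar_field R k) :
  borel_version f F -> exists M : set R,
  [/\ measurable M, lebesgue_measure M = 0%E &
      forall x, ~ M x -> comp_pseudoinverse g f x = comp_pseudoinverse g F x].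
Proof.
move=> [mF [N [mN N0 fF]]].
exists (range (cont_part g) `&` pseudoinverse g @^-1` N); split.
- apply: measurableI; first exact: measurable_range_cont_part dE.
  by rewrite -[X in measurable X]setTI; apply: (measurable_pseudoinverse dE nconst).
- move: N0; rewrite (stieltjes_borelE dE nconst mN) => /eqP.
  by rewrite padde_eq0// => /andP[_ /eqP].
- move=> x Mx; rewrite /comp_pseudoinverse !patchE; case: ifPn => // /set_mem rx /=.
  by apply: fF => Nx; apply: Mx.
Qed.

Variable p : R.
Hypothesis p1 : 1 <= p.

(** Stated for functions rather than classes, so that it gives distances of classes and, with the
    zero function for [h], norms. *)
Lemma integral_stieltjes_version (f h F H : R -> scalar_field R k) :
  scalar_measurable (f : caratheodory_type (stieltjes_outer g) -> _) ->
  scalar_measurable (h : caratheodory_type (stieltjes_outer g) -> _) ->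
  borel_version f F -> borel_version h H ->
  (\int[stieltjes g]_x emodulus_pow p (f x - h x) =
   \esum_(i in I) (emodulus_pow p (f (d i) - h (d i)) * (jump g (d i))%:E) +
   \int[lebesgue_measure]_x
     emodulus_pow p (comp_pseudoinverse g F x - comp_pseudoinverse g H x))%E.
Proof.
move=> mf mh vf vh.
have [mF [N1 [mN1 N10 fF]]] := vf; have [mH [N2 [mN2 N20 hH]]] := vh.
pose u x := emodulus_pow p (F x - H x).
have mu_ : measurable_fun setT u.
  exact: (measurable_emodulus_pow p (scalar_measurableB mF mH)).
have mid : measurable_fun setT (id : caratheodory_type (stieltjes_outer g) -> R).
  by move=> _ A mA; rewrite setTI; exact: borel_caratheodory.
have -> : (\int[stieltjes g]_x emodulus_pow p (f x - h x) = \int[stieltjes g]_x u x)%E.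
  apply: ge0_ae_eq_integral; [exact: measurableT| | | | |].
  - exact: (measurable_emodulus_pow p (scalar_measurableB mf mh)).
  - exact: (measurableT_comp mu_ mid).
  - by move=> x _; exact: emodulus_pow_ge0.
  - by move=> x _; exact: emodulus_pow_ge0.
  - exists (N1 `|` N2); split.
    + by apply: measurableU; exact: borel_caratheodory.
    + by apply: measureU_eq0; [exact: borel_caratheodory..| |].
    + move=> x /= h0; apply: contrapT => /not_orP[Nx1 Nx2]; apply: h0 => _.
      by rewrite /u fF// hH.
have u0 x : (0 <= u x)%E by exact: emodulus_pow_ge0.
rewrite (integral_stieltjes_borel g mu_ u0) (integral_stieltjes_split dE nconst mu_ u0).
apply: (f_equal2 (fun a b : \bar R => a + b)%E).
  by apply: eq_esum => i Ii; rewrite /u (borel_version_jump vf Ii) (borel_version_jump vh Ii).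
rewrite integral_mkcond; apply: eq_integral => x _.
rewrite /comp_pseudoinverse !patchE; case: ifP => //= _.
by rewrite subrr emodulus_pow0.
Qed.

Lemma class_fun_measurable (f : mfun_class k g) :
  scalar_measurable (class_fun f : caratheodory_type (stieltjes_outer g) -> _).
Proof.
apply: borel_scalar_measurable.
by rewrite /class_fun /aqEqMfun_to_fun; exact: measurable_funP.
Qed.

Lemma Lp_dist_lt (f h : mfun_class k g) (e : R) : 0 < e ->
  (Lp_dist p f h < e%:E)%E =
  (\int[stieltjes g]_x emodulus_pow p (class_fun f x - class_fun h x) < (e `^ p)%:E)%E.
Proof.
move=> e0; have p0 : 0 < p by exact: lt_le_trans p1.
have -> : (\int[stieltjes g]_x emodulus_pow p (class_fun f x - class_fun h x) =
    Lp_dist p f h `^ p)%E.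
  rewrite /Lp_dist poweR_Lnorm; last by rewrite gt_eqF.
  apply: eq_integral => x _ /=.
  by rewrite ger0_norm ?modulus_ge0.
have : (0 <= Lp_dist p f h)%E by exact: Lnorm_ge0.
case: (Lp_dist p f h) => [r| |] //; last by rewrite poweRyr ?gt_eqF// ltNge leey.
rewrite lee_fin poweR_EFin !lte_fin => r0.
apply/idP/idP => re; first by rewrite gt0_ltr_powR// nnegrE// ltW.
by rewrite ltNge; apply/negP => er; move: re; rewrite ltNge ge0_ler_powR// ?nnegrE// ltW.
Qed.

Lemma Lp_set_lt (f : mfun_class k g) : Lp_set p f ->
  (\int[stieltjes g]_x emodulus_pow p (class_fun f x - 0) < +oo)%E.
Proof.
have p0 : 0 < p by exact: lt_le_trans p1.
rewrite /Lp_set/= /finite_norm => fp.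
have -> : (\int[stieltjes g]_x emodulus_pow p (class_fun f x - 0) =
    'N[stieltjes g]_p%:E[EFin \o (modulus (k:=k) \o class_fun f)]%R `^ p)%E.
  rewrite poweR_Lnorm; last by rewrite gt_eqF.
  apply: eq_integral => x _ /=.
  by rewrite ger0_norm ?modulus_ge0 ?subr0.
by rewrite poweR_lty.
Qed.

Lemma integral_completed_comp_pseudoinverse (D : set R) (f F : R -> scalar_field R k) :
  measurable D -> borel_version f F ->
  (\int[completed_lebesgue_measure]_(x in D) emodulus_pow p (comp_pseudoinverse g f x) =
   \int[lebesgue_measure]_(x in D) emodulus_pow p (comp_pseudoinverse g F x))%E.
Proof.
move=> mD vF; have [M [mM M0 fF]] := comp_pseudoinverse_version vF.
apply: (integral_completed_ae mD mM M0) => //; last by move=> x /fF ->.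
exact: (measurable_emodulus_pow p (scalar_measurable_pseudoinverse vF.1)).
Qed.

Lemma integral_completed_translate (f F : R -> scalar_field R k) (h : R) :
  borel_version f F ->
  (\int[completed_lebesgue_measure]_x
     emodulus_pow p (comp_pseudoinverse g f (x + h) - comp_pseudoinverse g f x) =
   \int[lebesgue_measure]_x
     emodulus_pow p (comp_pseudoinverse g F (x + h) - comp_pseudoinverse g F x))%E.
Proof.
move=> vF; have [M [mM M0 fF]] := comp_pseudoinverse_version vF.
have mh := measurable_addr h.
have mMh : measurable ((fun x => x + h) @^-1` M).
  by rewrite -[X in measurable X]setTI; exact: mh.
apply: (@integral_completed_ae _ _ (M `|` (fun x => x + h) @^-1` M)) => //.
- exact: measurableU.
- by apply: measureU_eq0 => //; rewrite [LHS]lebesgue_measure_shift.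
- have mF := scalar_measurable_pseudoinverse vF.1.
  exact: (measurable_emodulus_pow p (scalar_measurableB (scalar_measurable_comp mF mh) mF)).
- by move=> x /not_orP[Mx Mhx]; rewrite fF// fF.
Qed.

End class_borel.

(** * Continuity of translations *)

Lemma lteeM_add (R : realType) (c e : R) (a b : \bar R) : 0 < c ->
  (a < (e / (c * 2))%:E)%E -> (b < (e / (c * 2))%:E)%E -> (c%:E * (a + b) < e%:E)%E.
Proof.
move=> c0 ae be; apply: (@lt_le_trans _ _ (c%:E * ((e / (c * 2))%:E + (e / (c * 2))%:E))%E).
  by rewrite lte_pmul2l// lteD.
rewrite -EFinD -EFinM lee_fin le_eqVlt; apply/orP; left; apply/eqP.
by field; rewrite gt_eqF.
Qed.

Lemma le_integral_powR d (T : measurableType d) (R : realType)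
    (mu : {measure set T -> \bar R}) (p : R) (a b : T -> R) : 0 <= p ->
  measurable_fun setT a -> measurable_fun setT b -> (forall x, 0 <= a x <= b x) ->
  (\int[mu]_x (a x `^ p)%:E <= \int[mu]_x (b x `^ p)%:E)%E.
Proof.
move=> p0 ma mb ab.
have m (c : T -> R) : measurable_fun setT c -> measurable_fun setT (fun x => (c x `^ p)%:E).
  move=> mc; apply/measurable_EFinP.
  exact: (measurableT_comp (@measurable_powR R p) mc).
apply: ge0_le_integral => //.
- by move=> x _; rewrite lee_fin powR_ge0.
- exact: m.
- exact: m.
- move=> x _; have /andP[a0 axb] := ab x.
  by rewrite lee_fin ge0_ler_powR// nnegrE// (le_trans a0).
Qed.

Section translation_continuity.
Context {R : realType}.
Variable p : R.
Hypothesis p1 : 1 <= p.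
Let p0 : 0 < p. Proof. exact: lt_le_trans p1. Qed.
Let K0 : 0 < (2 : R) `^ p. Proof. by rewrite powR_gt0. Qed.
Let frac0 (e : R) : 0 < e -> 0 < e / (2 `^ p * 2).
Proof. by move=> e0; rewrite divr_gt0// mulr_gt0. Qed.

Section generic.
Context {k : scalar_kind}.
Implicit Types F G : R -> scalar_field R k.

Definition translation_continuous F := forall e : R, 0 < e ->
  exists2 rho : R, 0 < rho & forall h, `|h| < rho ->
  (\int[lebesgue_measure]_x emodulus_pow p (F (x + h)%R - F x)%R < e%:E)%E.

Lemma integral_translate2 F G h : scalar_measurable F -> scalar_measurable G ->
  (\int[lebesgue_measure]_x emodulus_pow p (F (x + h)%R - G (x + h)%R)%R =
   \int[lebesgue_measure]_x emodulus_pow p (F x - G x)%R)%E.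
Proof.
move=> mF mG.
have := @integral_shift R h setT (fun x => emodulus_pow p (F x - G x)) measurableT.
rewrite preimage_setT => -> //.
exact: (measurable_emodulus_pow p (scalar_measurableB mF mG)).
Qed.

Lemma scalar_measurable_shift F h : scalar_measurable F ->
  scalar_measurable (fun x : R => F (x + h)).
Proof. by move=> mF; exact: (scalar_measurable_comp mF (measurable_addr h)). Qed.

(** Two quasi-triangle inequalities through the translate of [G] and [G] itself; translation
    invariance makes the two outer errors equal. *)
Lemma integral_translate_approx F G h : scalar_measurable F -> scalar_measurable G ->
  (\int[lebesgue_measure]_x emodulus_pow p (F (x + h)%R - F x)%R <=
   (2 `^ p)%:E * (\int[lebesgue_measure]_x emodulus_pow p (F x - G x)%R +
     (2 `^ p)%:E * (\int[lebesgue_measure]_x emodulus_pow p (G (x + h)%R - G x)%R +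
                    \int[lebesgue_measure]_x emodulus_pow p (F x - G x)%R)))%E.
Proof.
move=> mF mG; have mFh := scalar_measurable_shift h mF.
have mGh := scalar_measurable_shift h mG.
apply: le_trans (integral_emodulus_triangle p1 lebesgue_measure measurableT mFh mGh mF) _.
rewrite (integral_translate2 h mF mG).
have -> : (\int[lebesgue_measure]_x emodulus_pow p (F x - G x)%R =
    \int[lebesgue_measure]_x emodulus_pow p (G x - F x)%R)%E.
  by apply: eq_integral => x _; rewrite emodulus_powB.
apply: lee_wpmul2l; first by rewrite lee_fin ltW.
apply: leeD2l.
exact: (integral_emodulus_triangle p1 lebesgue_measure measurableT mGh mG mF).
Qed.

Lemma translation_continuous_approx F : scalar_measurable F ->
  (forall e : R, 0 < e -> exists G, [/\ scalar_measurable G, translation_continuous G &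
     (\int[lebesgue_measure]_x emodulus_pow p (F x - G x)%R < e%:E)%E]) ->
  translation_continuous F.
Proof.
(* [e1] is the share of each term at the outer level of [integral_translate_approx] and [e2] at the
   inner level. The error between [F] and [G] occurs at both, whence the minimum. *)
move=> mF approx e e0; pose e1 := e / (2 `^ p * 2); pose e2 := e1 / (2 `^ p * 2).
have e10 : 0 < e1 by exact: frac0.
have e20 : 0 < e2 by exact: frac0.
pose e3 := Num.min e1 e2.
have e30 : 0 < e3 by rewrite lt_min e10.
have [G [mG tG FG]] := approx e3 e30.
have [rho rho0 Grho] := tG e2 e20.
exists rho => // h /Grho hG; apply: le_lt_trans (integral_translate_approx h mF mG) _.
apply: lteeM_add => //; first by rewrite (lt_le_trans FG)// lee_fin ge_min lexx.
by apply: lteeM_add; [exact: K0|exact: hG|rewrite (lt_le_trans FG)// lee_fin ge_min lexx orbT].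
Qed.

End generic.

Let real_fun := R -> scalar_field R RealScalars.

Lemma real_scalar_measurable (u : R -> R) : measurable_fun setT u ->
  scalar_measurable (u : real_fun).
Proof. by move=> mu; split => //=; exact: measurable_cst. Qed.

(** One domination argument for three reductions: to the terms of a sum, to positive and negative
    parts, to real and imaginary parts. *)
Lemma translation_continuous_le {k : scalar_kind} (F : R -> scalar_field R k) (u v : R -> R) :
  scalar_measurable F -> measurable_fun setT u -> measurable_fun setT v ->
  (forall x y, modulus (F x - F y) <= `|u x - u y| + `|v x - v y|) ->
  translation_continuous (u : real_fun) -> translation_continuous (v : real_fun) ->
  translation_continuous F.
Proof.
move=> mF /real_scalar_measurable mu /real_scalar_measurable mv Fuv tu tv e e0.
pose e1 := e / (2 `^ p * 2); have e10 : 0 < e1 by exact: frac0.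
have [ru ru0 hu] := tu e1 e10; have [rv rv0 hv] := tv e1 e10.
exists (Num.min ru rv) => [|h]; first by rewrite lt_min ru0.
rewrite lt_min => /andP[hru hrv].
have m k1 (G : R -> scalar_field R k1) : scalar_measurable G ->
    measurable_fun setT (fun x : R => emodulus_pow p (G (x + h)%R - G x)).
  move=> mG; exact: (measurable_emodulus_pow p
    (scalar_measurableB (scalar_measurable_shift h mG) mG)).
apply: le_lt_trans (lteeM_add K0 (hu _ hru) (hv _ hrv)).
rewrite -ge0_integralD//; last 2 first.
- exact: (m _ _ mu).
- exact: (m _ _ mv).
rewrite -ge0_integralZl//; last 2 first.
- by apply: emeasurable_funD; [exact: (m _ _ mu)|exact: (m _ _ mv)].
- by move=> x _; rewrite adde_ge0// emodulus_pow_ge0.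
apply: ge0_le_integral => //.
- exact: (m _ _ mF).
- by apply: emeasurable_funM => //; apply: emeasurable_funD; [exact: (m _ _ mu)|exact: (m _ _ mv)].
- move=> x _; rewrite -EFinD -EFinM lee_fin; apply: powRD_le;
    [exact: p1|exact: modulus_ge0|exact: modulus_ge0| |].
  + exact: modulus_ge0.
  + exact: Fuv.
Qed.

Lemma translation_continuousD (u v : R -> R) :
  measurable_fun setT u -> measurable_fun setT v ->
  translation_continuous (u : real_fun) -> translation_continuous (v : real_fun) ->
  translation_continuous ((fun x => u x + v x) : real_fun).
Proof.
move=> mu mv; apply: translation_continuous_le => //.
  by apply: real_scalar_measurable; exact: measurable_funD.
move=> x y /=; rewrite (_ : u x + v x - (u y + v y) = (u x - u y) + (v x - v y)); last by ring.
exact: ler_normD.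
Qed.

(** * From sets of finite measure to p-integrable functions *)

Lemma measurable_shift_preimage h (A : set R) : measurable A ->
  measurable ((fun x => x + h) @^-1` A).
Proof.
by move=> mA; rewrite -[X in measurable X]setTI; apply: (measurable_addr h).
Qed.

(** Continuity of addition at each (x, 0) bounds [h] locally, and compactness makes the bound
    uniform. *)
Lemma compact_open_translate (K U : set R) : compact K -> open U -> K `<=` U ->
  exists2 rho : R, 0 < rho & forall h, `|h| < rho -> K `<=` [set x | U (x + h)].
Proof.
move=> cK oU KU.
have cov := (compact_near_coveringP K).1 cK R (nbhs 0) (fun h x => U (x + h)) (nbhs_filter 0).
have /cov /nbhs_ballP[rho /= rho0 hrho] : forall x, K x ->
    \forall x' \near x & i \near nbhs 0, U (x' + i).
  move=> x Kx.
  have Ux : \forall y \near (x + 0 : R), U y.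
    by rewrite addr0; apply: open_nbhs_nbhs; split => //; exact: KU.
  have [[P Q] /= [Px Q0] PQ] := @add_continuous R (x, 0) _ Ux.
  by exists (P, Q) => // -[a b] /= [Pa Qb]; apply: (PQ (a, b)).
exists rho => // h hr; apply: hrho => /=.
by rewrite /ball/= sub0r normrN.
Qed.

(** Enclose [A] between a compact [K] and an open [U], each with error e/4. When translations by [h]
    and [- h] keep [K] inside [U], a point that lies in only one of [A] and its translate belongs to
    [A \ K], to [U \ A], or to the translate of one of them: four sets of measure less than e/4. *)
Lemma lebesgue_translate_diff (A : set R) : measurable A -> (lebesgue_measure A < +oo)%E ->
  forall e : R, 0 < e -> exists2 rho : R, 0 < rho & forall h, `|h| < rho ->
  (lebesgue_measure ((A `\` (fun x : R => x + h)%R @^-1` A) `|`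
                     ((fun x : R => x + h)%R @^-1` A `\` A)) < e%:E)%E.
Proof.
move=> mA Aoo e e0; have e40 : 0 < e / 4 by rewrite divr_gt0.
have [U [oU AU UA]] := lebesgue_regularity_outer mA Aoo e40.
have [K [cK KA AK]] := lebesgue_regularity_inner mA Aoo e40.
have [rho rho0 hrho] := compact_open_translate cK oU (subset_trans KA AU).
have mU : measurable U by exact: open_measurable.
have mK : measurable K.
  by apply: closed_measurable; apply: compact_closed => //; exact: Rhausdorff.
have mAK : measurable (A `\` K) by exact: measurableD.
have mUA : measurable (U `\` A) by exact: measurableD.
exists rho => // h hr.
have mh := measurable_shift_preimage h.
have mAh := mh _ mA; have mAKh := mh _ mAK; have mUAh := mh _ mUA.
pose E1 := (A `\` K) `|` (fun x => x + h) @^-1` (U `\` A).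
pose E2 := (U `\` A) `|` (fun x => x + h) @^-1` (A `\` K).
have mE1 : measurable E1 by exact: measurableU.
have mE2 : measurable E2 by exact: measurableU.
apply: (@le_lt_trans _ _ (lebesgue_measure (E1 `|` E2))).
  apply: le_measure; rewrite ?inE.
  - by apply: measurableU; exact: measurableD.
  - exact: measurableU.
  - move=> x [[Ax Axh]|[Axh Ax]].
      left; have [Kx|Kx] := pselect (K x); last by left.
      by right; split => //; exact: hrho.
    right; have [Kxh|Kxh] := pselect (K (x + h)); last by right.
    left; split => //.
    by have := hrho (- h); rewrite normrN => /(_ hr _ Kxh) /=; rewrite addrK.
apply: (@le_lt_trans _ _ (lebesgue_measure E1 + lebesgue_measure E2)%E).
  exact: measureU2.
have quarter : (e / 4 + e / 4 + (e / 4 + e / 4)) = e by field.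
rewrite -quarter EFinD; apply: lteD.
  apply: (@le_lt_trans _ _ (lebesgue_measure (A `\` K) +
    lebesgue_measure ((fun x => x + h)%R @^-1` (U `\` A)))%E).
    exact: measureU2.
  by rewrite lebesgue_measure_shift// EFinD; exact: lteD.
apply: (@le_lt_trans _ _ (lebesgue_measure (U `\` A) +
  lebesgue_measure ((fun x => x + h)%R @^-1` (A `\` K)))%E).
  exact: measureU2.
by rewrite lebesgue_measure_shift// EFinD; exact: lteD.
Qed.

(** The alternative [c = 0] covers the zero level of a simple function, whose measure may be
    infinite. *)
Lemma translation_continuous_indic (c : R) (A : set R) :
  measurable A -> (lebesgue_measure A < +oo)%E \/ c = 0 ->
  translation_continuous ((fun x => c * \1_A x) : real_fun).
Proof.
move=> mA [Aoo|->] e e0; last first.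
  exists 1 => // h _.
  rewrite (eq_integral (cst 0%E)) ?integral0// => x _ /=.
  by rewrite /emodulus_pow/= !mul0r subrr normr0 powR0// gt_eqF.
(* The [1] keeps the denominator positive, as [c] may vanish here too. *)
have c0 : 0 < `|c| `^ p + 1 by rewrite ltr_wpDl// powR_ge0.
have [rho rho0 hrho] := lebesgue_translate_diff mA Aoo (divr_gt0 e0 c0).
exists rho => // h hr; have mh := measurable_shift_preimage h mA.
set Ah := (fun x : R => x + h) @^-1` A in mh.
pose S := (A `\` Ah) `|` (Ah `\` A).
have mS : measurable S by apply: measurableU; exact: measurableD.
rewrite (eq_integral (fun x : measurableTypeR R => (`|c| `^ p)%:E * (\1_S x)%:E)%E); last first.
  move=> x _; rewrite /emodulus_pow/= -EFinM; congr EFin; rewrite !indicE.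
  have -> : (x \in S) = ((x \in A) != (x + h \in A)).
    apply/idP/idP => [/set_mem[[xA xhA]|[xhA xA]]|].
    - by rewrite (mem_set xA) memNset.
    - by rewrite (memNset xA) [x + h \in A](mem_set xhA).
    - case: (boolP (x \in A)) => xA /=; case: (boolP (x + h \in A)) => xhA // _; apply/mem_set.
        by left; split; [exact: set_mem|move/mem_set; exact/negP].
      by right; split; [exact: set_mem|move/mem_set; exact/negP].
  case: (x \in A) => /=; case: (x + h \in A) => /=;
    by rewrite ?mulr0 ?mulr1 ?subrr ?subr0 ?sub0r ?normrN ?normr0 ?powR0 ?gt_eqF.
rewrite ge0_integralZl//; last exact/measurable_EFinP/measurable_indic.
rewrite integral_indic// setIT.
apply: (@le_lt_trans _ _ ((`|c| `^ p + 1)%:E * lebesgue_measure S)%E).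
  by apply: lee_wpmul2r; rewrite ?measure_ge0// lee_fin lerDl.
rewrite -[e](@divfK _ (`|c| `^ p + 1)) ?gt_eqF// mulrC EFinM lte_pmul2l//.
  exact: hrho.
Qed.

Lemma translation_continuous_sum n (u : 'I_n -> R -> R) :
  (forall i, measurable_fun setT (u i)) ->
  (forall i, translation_continuous (u i : real_fun)) ->
  translation_continuous ((fun x => \sum_(i < n) u i x) : real_fun).
Proof.
elim: n u => [|n IH] u mu tu.
  move=> e e0; exists 1 => // h _.
  rewrite (eq_integral (cst 0%E)) ?integral0// => x _ /=.
  by rewrite !big_ord0 subrr (emodulus_pow0 p1).
rewrite (_ : (fun x => _) =
    (fun x => \sum_(i < n) u (widen_ord (leqnSn n) i) x + u ord_max x)); last first.
  by apply/funext => x; rewrite big_ord_recr.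
apply: translation_continuousD => //; last exact: IH.
exact: measurable_sum.
Qed.

Import HBNNSimple.

(** By Chebyshev's inequality a positive level has finite measure; a negative level is empty and the
    zero level contributes nothing. *)
Lemma translation_continuous_nnsfun (s : {nnsfun R >-> R}) :
  (\int[lebesgue_measure]_x (s x `^ p)%:E < +oo)%E ->
  translation_continuous (s : real_fun).
Proof.
move=> soo.
have [n [y sE]] : exists n (y : 'I_n -> R),
    forall x, s x = \sum_(i < n) (y i * \1_(s @^-1` [set y i]) x).
  by eexists; eexists; exact: fimfunEord.
have ms i : measurable (s @^-1` [set y i]).
  exact: measurable_sfunP.
rewrite (_ : (s : R -> R) = (fun x => \sum_(i < n) (y i * \1_(s @^-1` [set y i]) x))); last first.
  exact/funext.
apply: translation_continuous_sum => i.
  exact: measurable_funM.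
apply: translation_continuous_indic => //.
have [->|y0] := eqVneq (y i) 0; [by right|left].
have [yge0|ylt0] := leP 0 (y i); last first.
  rewrite (_ : _ @^-1` _ = set0) ?measure0//.
  apply/seteqP; split => // x /= sxy; have : 0 <= s x by exact: fun_ge0.
  by rewrite sxy leNgt ylt0.
have msi := ms i.
have yp0 : 0 < y i `^ p by rewrite powR_gt0// lt0r y0.
have : ((y i `^ p)%:E * lebesgue_measure (s @^-1` [set y i]) < +oo)%E.
  apply: le_lt_trans soo.
  rewrite -[X in (_ * lebesgue_measure X)%E]setIT -integral_indic//.
  rewrite -ge0_integralZl//; last 2 first.
  - exact/measurable_EFinP/measurable_indic.
  - by rewrite lee_fin ltW.
  apply: ge0_le_integral => //.
  - by move=> x _; rewrite mule_ge0// ?lee_fin ?indicE// ltW.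
  - exact/measurable_funeM/measurable_EFinP/measurable_indic.
  - have ms0 : measurable_fun setT (s : R -> R) by [].
    by apply/measurable_EFinP; exact: (measurableT_comp (@measurable_powR R p) ms0).
  move=> x _; rewrite -EFinM lee_fin indicE.
  case: (boolP (x \in _)) => [/set_mem <-|_]; first by rewrite mulr1.
  by rewrite mulr0 powR_ge0.
case: (lebesgue_measure _) => [r _| |//]; first by rewrite ltry.
by rewrite gt0_muley.
Qed.

(** Simple functions [s n] below [u] approximate it by dominated convergence: the p-th power of the
    error is at most that of [u]. *)
Lemma translation_continuous_ge0 (u : R -> R) :
  measurable_fun setT u -> (forall x, 0 <= u x) ->
  (\int[lebesgue_measure]_x (u x `^ p)%:E < +oo)%E ->
  translation_continuous (u : real_fun).
Proof.
move=> mu u0 uoo.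
have mue : measurable_fun setT (EFin \o u) by exact/measurable_EFinP.
pose s := nnsfun_approx measurableT mue.
have scv x : EFin (s n x) @[n --> \oo] --> (u x)%:E.
  by apply: (cvg_nnsfun_approx measurableT mue) => // y _; rewrite lee_fin.
have s0 n x : 0 <= s n x by exact: fun_ge0.
have su n x : s n x <= u x.
  rewrite -lee_fin; move/cvg_lim : (scv x) => <- //.
  apply: lime_ge; first by apply/cvg_ex; eexists; exact: scv.
  near=> m; rewrite lee_fin; apply/lefP/nd_nnsfun_approx.
  by near: m; exact: nbhs_infty_ge.
apply: translation_continuous_approx; first exact: real_scalar_measurable.
move=> e e0.
have ms n : measurable_fun setT (s n : R -> R) by [].
have mpow (v : R -> R) : measurable_fun setT v ->
    measurable_fun setT (fun x : measurableTypeR R => (v x `^ p)%:E).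
  move=> mv; apply/measurable_EFinP; exact: (measurableT_comp (@measurable_powR R p) mv).
have mus n : measurable_fun setT (fun x => `|u x - s n x|).
  by apply: measurableT_comp => //; exact: measurable_funB.
have cv : (\int[lebesgue_measure]_x (`|u x - s n x| `^ p)%:E @[n --> \oo] -->
    \int[lebesgue_measure]_(x in setT) (cst 0 x))%E.
  apply: (@dominated_cvg _ (measurableTypeR R) R lebesgue_measure setT measurableT
    (fun n x => (`|u x - s n x| `^ p)%:E) (cst 0%E) (fun x => (u x `^ p)%:E)) => //.
  - by move=> n; exact: mpow.
  - move=> x _; apply: cvg_EFin; first exact: nearW.
    (* An error below r^(1/p) in the values is an error below [r] in their p-th powers. *)
    apply/cvgrPdist_lt => r r0; have rp0 : 0 < r `^ p^-1 by rewrite powR_gt0.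
    have /fine_cvgP[_ /cvgrPdist_lt/(_ _ rp0)] := scv x.
    apply: filterS => m /= um; rewrite sub0r normrN ger0_norm ?powR_ge0//.
    rewrite -[ltRHS](powRr1 (ltW r0)) -(mulVf (lt0r_neq0 p0)) powRrM.
    by rewrite gt0_ltr_powR// ?nnegrE ?ltW// ltW.
  - apply/integrableP; split; first exact: mpow.
    rewrite (eq_integral (fun x : measurableTypeR R => (u x `^ p)%:E))//.
    by move=> x _; rewrite gee0_abs// lee_fin powR_ge0.
  - move=> n x _; rewrite gee0_abs ?lee_fin ?powR_ge0// ge0_ler_powR ?(ltW p0)// ?nnegrE//.
    by rewrite ger0_norm ?subr_ge0// gerBl.
rewrite integral0 in cv.
have [n hn] : exists n, (\int[lebesgue_measure]_x (`|u x - s n x| `^ p)%:E < e%:E)%E.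
  have : nbhs 0%E [set y : \bar R | (y < e%:E)%E].
    by apply: open_nbhs_nbhs; split; [exact: open_ereal_lt_ereal|rewrite /= lte_fin].
  by move=> /cv [N _ hN]; exists N; exact: (hN N (leqnn N)).
exists (s n); split => //.
- exact: real_scalar_measurable.
- apply: translation_continuous_nnsfun; apply: le_lt_trans uoo.
  apply: le_integral_powR; [exact: ltW|exact: ms|exact: mu|].
  by move=> x; apply/andP; split; [exact: s0|exact: su].
Unshelve. all: by end_near. Qed.

Lemma translation_continuous_real (u : R -> R) :
  measurable_fun setT u ->
  (\int[lebesgue_measure]_x (`|u x| `^ p)%:E < +oo)%E ->
  translation_continuous (u : real_fun).
Proof.
move=> mu uoo.
have part (v : R -> R) : measurable_fun setT v -> (forall x, 0 <= v x <= `|u x|) ->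
    translation_continuous (v : real_fun).
  move=> mv vu; apply: translation_continuous_ge0; first exact: mv.
    by move=> x; have /andP[] := vu x.
  apply: le_lt_trans uoo; apply: le_integral_powR; [exact: ltW|exact: mv| |exact: vu].
  exact: measurableT_comp.
have mp := measurable_funrpos mu; have mn := measurable_funrneg mu.
have cmp x : u x = u^\+ x - u^\- x.
  by rewrite -{1}(funrposBneg u).
apply: (translation_continuous_le (u := u^\+) (v := u^\-)).
- exact: real_scalar_measurable.
- exact: mp.
- exact: mn.
- move=> x y; rewrite [modulus _](_ : _ = `|u x - u y|)//.
  rewrite (cmp x) (cmp y).
  rewrite (_ : _ - _ = (u^\+ x - u^\+ y) - (u^\- x - u^\- y)); last by ring.
  exact: ler_normB.
- by apply: part => // x; rewrite funrpos_ge0/= /funrpos ge_max ler_norm normr_ge0.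
- by apply: part => // x; rewrite funrneg_ge0/= /funrneg ge_max ler_normr lexx orbT normr_ge0.
Qed.

Lemma translation_continuous_scalar {k} (F : R -> scalar_field R k) :
  scalar_measurable F ->
  (\int[lebesgue_measure]_x emodulus_pow p (F x) < +oo)%E ->
  translation_continuous F.
Proof.
move=> mF Foo; have [mr mi] := mF.
have part (v : R -> R) : measurable_fun setT v -> (forall x, `|v x| <= modulus (F x)) ->
    translation_continuous (v : real_fun).
  move=> mv vF; apply: translation_continuous_real; first exact: mv.
  apply: le_lt_trans Foo; apply: le_integral_powR; [exact: ltW| | |].
  - exact: measurableT_comp.
  - exact: measurable_modulus.
  - by move=> x; rewrite normr_ge0 vF.
apply: (translation_continuous_le mF mr mi).
- by move=> x y; rewrite /= -scalar_reB -scalar_imB; exact: modulus_le_reim.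
- by apply: part => // x; exact: modulus_re.
- by apply: part => // x; exact: modulus_im.
Qed.

End translation_continuity.

(** * Sampling *)

Section sampling.
Context {R : realType} {k : scalar_kind}.
Variable p : R.
Implicit Type F : R -> scalar_field R k.

Definition cell (a delta : R) (j : nat) : set R :=
  `[a + j%:R * delta, a + j.+1%:R * delta[%classic.

Lemma measurable_cell a delta j : measurable (cell a delta j).
Proof. exact: measurable_itv. Qed.

Lemma lebesgue_measure_cell a delta j : 0 < delta ->
  lebesgue_measure (cell a delta j) = delta%:E.
Proof.
move=> d0; rewrite /cell lebesgue_measure_itv/= lte_fin ltrD2l ltr_pM2r// ltr_nat ltnSn.
by rewrite -EFinB; congr EFin; rewrite -natr1; ring.
Qed.

Lemma integral_cells a delta n (f : R -> \bar R) : 0 < delta ->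
  measurable_fun setT f -> (forall x, 0 <= f x)%E ->
  (\sum_(j < n) \int[lebesgue_measure]_(x in cell a delta j) f x =
   \int[lebesgue_measure]_(x in `[a, (a + n%:R * delta)%R[) f x)%E.
Proof.
move=> d0 mf f0; elim: n => [|n IH].
  by rewrite big_ord0 mul0r addr0 set_itvco0 integral_set0.
rewrite big_ord_recr/= IH -ge0_integral_setU//.
- congr integral; rewrite /cell -itv_bndbnd_setU// bnd_simp.
    by rewrite lerDl mulr_ge0// ltW.
  by rewrite lerD2l ler_pM2r// ler_nat.
- exact: measurable_cell.
- exact: measurable_funTS.
- rewrite disj_set2E; apply/eqP/seteqP; split => // x [] /=; rewrite /cell/= !in_itv/=.
  by move=> /andP[_ xn] /andP[nx _]; move: (lt_le_trans xn nx); rewrite ltxx.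
Qed.

(** The slack [tau] stands in for strict monotonicity of the integral: a function above [c + tau]
    throughout [D] has integral at least [delta * (c + tau)]. *)
Lemma exists_le_mean (D : set R) (delta c tau : R) (S : R -> \bar R) :
  measurable D -> lebesgue_measure D = delta%:E -> 0 < delta -> 0 < tau ->
  measurable_fun D S -> (forall x, D x -> 0 <= S x)%E ->
  (\int[lebesgue_measure]_(z in D) S z <= (delta * c)%:E)%E ->
  exists2 z, D z & (S z <= (c + tau)%:E)%E.
Proof.
move=> mD D_delta d0 t0 mS S0 Sc; apply: contrapT => nz.
have Slt z : D z -> ((c + tau)%:E <= S z)%E.
  by move=> Dz; rewrite leNgt; apply/negP => /ltW Sz; apply: nz; exists z.
have c0 : 0 <= c.
  rewrite -(pmulr_rge0 _ d0) -lee_fin; apply: le_trans Sc.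
  exact: integral_ge0.
have : (\int[lebesgue_measure]_(z in D) (cst (c + tau)%:E) z <= (delta * c)%:E)%E.
  apply: le_trans Sc; apply: ge0_le_integral => //.
  by move=> z _; rewrite lee_fin addr_ge0// ltW.
rewrite integral_cst// [X in (_ * X)%E]D_delta -EFinM lee_fin mulrC ler_pM2l// leNgt ltrDl.
by rewrite t0.
Qed.

Let Phi F (x z : R) := emodulus_pow p (F x - F z).

Let mPhi F : scalar_measurable F ->
  measurable_fun setT (fun zh : (measurableTypeR R * measurableTypeR R)%type =>
    Phi F (zh.1 + zh.2) zh.1).
Proof.
move=> mF.
have m1 : measurable_fun setT (fun zh : (measurableTypeR R * measurableTypeR R)%type =>
    (zh.1 + zh.2 : R)).
  by apply: measurable_funD; [exact: measurable_fst|exact: measurable_snd].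
have m2 : measurable_fun setT (fun zh : (measurableTypeR R * measurableTypeR R)%type =>
    (zh.1 : R)).
  exact: measurable_fst.
exact: (measurable_emodulus_pow p (scalar_measurableB
  (scalar_measurable_comp mF m1) (scalar_measurable_comp mF m2))).
Qed.

Let mdiff F : scalar_measurable F ->
  measurable_fun setT (fun zx : (measurableTypeR R * measurableTypeR R)%type =>
    Phi F zx.2 zx.1).
Proof.
move=> mF.
have m1 : measurable_fun setT (fun zh : (measurableTypeR R * measurableTypeR R)%type =>
  (zh.1 : R)) by exact: measurable_fst.
have m2 : measurable_fun setT (fun zh : (measurableTypeR R * measurableTypeR R)%type =>
  (zh.2 : R)) by exact: measurable_snd.
exact: (measurable_emodulus_pow p (scalar_measurableB
  (scalar_measurable_comp mF m2) (scalar_measurable_comp mF m1))).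
Qed.

Section section_integral.
Variables (f : (measurableTypeR R * measurableTypeR R)%type -> \bar R) (D : set R).
Hypotheses (mD : measurable D) (mf : measurable_fun setT f) (f0 : forall x, (0 <= f x)%E).

(** The indicator of [D] turns integrals over [D] into integrals over the line, the form in which
    Tonelli's theorem is applied. *)
Let fD (zx : (measurableTypeR R * measurableTypeR R)%type) := ((\1_D zx.2)%:E * f zx)%E.

Let fD0 x : (0 <= fD x)%E.
Proof. by apply: mule_ge0 => //; rewrite lee_fin indicE. Qed.

Let mfD : measurable_fun setT fD.
Proof.
apply: emeasurable_funM => //; apply/measurable_EFinP.
by apply: (measurableT_comp (measurable_indic mD)); exact: measurable_snd.
Qed.

Let fDE z : (\int[lebesgue_measure]_(x in D) f (z, x) = \int[lebesgue_measure]_x fD (z, x))%E.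
Proof.
rewrite integral_mkcond; apply: eq_integral => x _; rewrite /fD/= patchE indicE.
by case: (x \in D); rewrite ?mul1e ?mul0e.
Qed.

Lemma measurable_section_integral :
  measurable_fun setT (fun z : R => \int[lebesgue_measure]_(x in D) f (z, x))%E.
Proof.
rewrite (_ : (fun _ => _) = fubini_F lebesgue_measure fD); last exact/funext.
exact: (measurable_fun_fubini_tonelli_F fD mfD fD0).
Qed.

Lemma fubini_tonelli_setr :
  (\int[lebesgue_measure]_z \int[lebesgue_measure]_(x in D) f (z, x) =
   \int[lebesgue_measure]_(x in D) \int[lebesgue_measure]_z f (z, x))%E.
Proof.
rewrite (eq_integral (fun z : measurableTypeR R =>
  \int[lebesgue_measure]_x fD (z, x))%E); last first.
  by move=> z _; exact: fDE.
rewrite (fubini_tonelli fD mfD fD0) [RHS]integral_mkcond.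
apply: eq_integral => x _; rewrite patchE /fD/= indicE; case: (x \in D).
  by apply: eq_integral => z _; rewrite mul1e.
by apply: integral0_eq => z _; rewrite mul0e.
Qed.

Lemma measurable_section_integralr :
  measurable_fun setT (fun x : R => \int[lebesgue_measure]_z f (z, x))%E.
Proof. exact: (measurable_fun_fubini_tonelli_G f mf f0). Qed.

End section_integral.

(** After exchanging the integrals, the inner one is at most [eta] for each [h], and [h] ranges over
    an interval of length [2 * delta]. *)
Lemma integral_translates_le F (delta eta : R) : 0 < delta -> scalar_measurable F ->
  (forall h, `|h| < delta ->
     (\int[lebesgue_measure]_x emodulus_pow p (F (x + h)%R - F x)%R <= eta%:E)%E) ->
  (\int[lebesgue_measure]_z
     \int[lebesgue_measure]_(h in `](- delta)%R, delta[) emodulus_pow p (F (z + h)%R - F z)%R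
   <= (delta * (2 * eta))%:E)%E.
Proof.
move=> d0 mF Feta; pose D : set R := `](- delta), delta[%classic.
have mD : measurable D by exact: measurable_itv.
have f0 (zh : (measurableTypeR R * measurableTypeR R)%type) :
  (0 <= Phi F (zh.1 + zh.2)%R zh.1)%E by exact: emodulus_pow_ge0.
rewrite (fubini_tonelli_setr mD (mPhi mF) f0)/=.
apply: (@le_trans _ _ (\int[lebesgue_measure]_(h in D) (cst eta%:E) h)%E).
  apply: ge0_le_integral.
  - exact: mD.
  - by move=> h _; apply: integral_ge0 => z _; exact: emodulus_pow_ge0.
  - exact: (measurable_funTS (measurable_section_integralr (mPhi mF) f0)).
  - exact: measurable_cst.
  - by move=> h; rewrite /D/= in_itv/= -ltr_norml => /Feta.
rewrite integral_cst// /D [X in (_ * X)%E]lebesgue_measure_itv/= lte_fin.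
rewrite gtrN// -EFinB -EFinM lee_fin le_eqVlt; apply/orP; left; apply/eqP; ring.
Qed.

(** Two points of one cell differ by less than [delta], so x = z + h with [h] in the interval on the
    right-hand side. *)
Lemma integral_cell_le F (a delta : R) j z : 0 < delta -> scalar_measurable F ->
  cell a delta j z ->
  (\int[lebesgue_measure]_(x in cell a delta j) emodulus_pow p (F x - F z)%R <=
   \int[lebesgue_measure]_(h in `](- delta)%R, delta[) emodulus_pow p (F (z + h)%R - F z)%R)%E.
Proof.
move=> d0 mF jz; pose f x := emodulus_pow p (F x - F z).
have mf : measurable_fun setT f.
  have mc : scalar_measurable (fun _ : R => F z) by exact: scalar_measurable_cst.
  exact: (measurable_emodulus_pow p (scalar_measurableB mF mc)).
have f0 x : (0 <= f x)%E by exact: emodulus_pow_ge0.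
rewrite -(@integral_shift R z (cell a delta j) f (measurable_cell _ _ _) mf f0).
rewrite (eq_integral (fun h : measurableTypeR R => f (z + h))); last by move=> h _; rewrite addrC.
apply: ge0_subset_integral.
- exact: measurable_shift_preimage (measurable_cell _ _ _).
- exact: measurable_itv.
- have ma : measurable_fun setT (fun h : R => z + h) by exact: measurable_funD.
  exact: (measurable_funTS (measurableT_comp mf ma)).
- by move=> x _; exact: f0.
- move=> h; move: jz; rewrite /cell/= !in_itv/= => /andP[jz zj] /andP[jh hj].
  have dj : (j.+1%:R : R) * delta = j%:R * delta + delta by rewrite -natr1; ring.
  by rewrite dj in zj hj; apply/andP; split; lra.
Qed.

(** Averaging over [z] in its cell, the errors [S j z] have means with sum at most [2 * eta], and
    each cell admits a point that exceeds its mean by at most [tau]. The slacks cost one more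
    [eta]. *)
Lemma sampling F (a delta eta : R) n : 0 < delta -> 0 < eta -> scalar_measurable F ->
  (forall h, `|h| < delta ->
     (\int[lebesgue_measure]_x emodulus_pow p (F (x + h)%R - F x)%R <= eta%:E)%E) ->
  exists z : 'I_n -> R,
  (\sum_(j < n) \int[lebesgue_measure]_(x in cell a delta j) emodulus_pow p (F x - F (z j))%R
     <= (3 * eta)%:E)%E.
Proof.
move=> d0 e0 mF Feta.
pose S (j : 'I_n) (z : R) : \bar R :=
  (\int[lebesgue_measure]_(x in cell a delta j) emodulus_pow p (F x - F z)%R)%E.
have mS j : measurable_fun setT (S j).
  exact: (measurable_section_integral (measurable_cell a delta j) (mdiff mF)
    (fun=> emodulus_pow_ge0 _ _)).
have S0 j z : (0 <= S j z)%E by apply: integral_ge0 => x _; exact: emodulus_pow_ge0.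
pose E (j : 'I_n) : \bar R := (\int[lebesgue_measure]_(z in cell a delta j) S j z)%E.
have E0 j : (0 <= E j)%E by exact: integral_ge0.
pose A (z : R) : \bar R := (\int[lebesgue_measure]_(h in `](- delta)%R, delta[)
  emodulus_pow p (F (z + h)%R - F z)%R)%E.
have mA : measurable_fun setT A.
  exact: (measurable_section_integral (measurable_itv _) (mPhi mF) (fun=> emodulus_pow_ge0 _ _)).
have A0 z : (0 <= A z)%E by apply: integral_ge0 => x _; exact: emodulus_pow_ge0.
have sumE : (\sum_(j < n) E j <= (delta * (2 * eta))%:E)%E.
  apply: le_trans (integral_translates_le d0 mF Feta).
  apply: (@le_trans _ _ (\sum_(j < n) \int[lebesgue_measure]_(z in cell a delta j) A z)%E).
    apply: lee_sum => j _; apply: ge0_le_integral.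
    - exact: measurable_cell.
    - by move=> z _; exact: S0.
    - exact: (measurable_funTS (mS j)).
    - exact: (measurable_funTS mA).
    - by move=> z; exact: integral_cell_le.
  rewrite (integral_cells _ _ d0 mA A0).
  by apply: ge0_subset_integral => //; exact: measurable_itv.
have Efin j : E j \is a fin_num.
  rewrite ge0_fin_numE//; apply: (@le_lt_trans _ _ (\sum_(j < n) E j)%E).
    by rewrite (bigD1 j)//= leeDl// sume_ge0.
  by rewrite (le_lt_trans sumE)// ltry.
(* The [n] slacks sum to at most [eta]; [n.+1] keeps the quotient positive for [n = 0]. *)
pose tau := eta / n.+1%:R; have tau0 : 0 < tau by rewrite divr_gt0.
have hz j : exists z, (S j z <= (fine (E j) / delta + tau)%:E)%E.
  have [|z _ Sz] := @exists_le_mean (cell a delta j) delta (fine (E j) / delta) tau (S j)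
    (measurable_cell _ _ _) (lebesgue_measure_cell _ _ d0) d0 tau0
    (measurable_funTS (mS j)) (fun x _ => S0 j x); last by exists z.
  by rewrite mulrC divfK ?gt_eqF// fineK.
have [z zP] := choice hz; exists z.
apply: (@le_trans _ _ (\sum_(j < n) (fine (E j) / delta + tau)%:E)%E).
  by apply: lee_sum => j _; exact: zP.
rewrite sumEFin lee_fin big_split/= -mulr_suml sumr_const card_ord.
have -> : 3 * eta = 2 * eta + eta by ring.
apply: lerD.
  rewrite ler_pdivrMr// mulrC -lee_fin -sumEFin.
  by under eq_bigr do rewrite fineK//.
rewrite -mulr_natr /tau mulrAC ler_pdivrMr// ler_pM2l// ler_nat.
exact: leqnSn.
Qed.

End sampling.

(** * Colourings and the Kolmogorov criterion *)

Section colorings.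
Context {R : realType} {T : Type}.
Implicit Types U : set T.

(* A colouring with finitely many colours whose classes have small diameter
   replaces a finite net: unlike a net it needs no centres, so that colourings of
   [U] for several pseudometrics combine by taking products of colours. *)
Definition finitely_colorable (dist : T -> T -> \bar R) U :=
  forall e : R, 0 < e -> exists (C : finType) (c : T -> C),
    forall x y, U x -> U y -> c x = c y -> (dist x y < e%:E)%E.

Lemma finitely_colorable_totally_bounded dist U :
  finitely_colorable dist U -> totally_bounded dist U.
Proof.
move=> Ucol e e0; have [C [c cP]] := Ucol e e0.
pose S := [set i : C | exists2 x, U x & c x = i].
have [[x0 Ux0]|U0] := pselect (U !=set0); last first.
  exists set0; split; [exact: finite_set0|exact: sub0set|].
  by move=> x Ux; case: U0; exists x.
(* A colour that does not occur in [U] receives the dummy [x0]; only the colours in [S] yield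
   centres. *)
have h i : exists t, S i -> U t /\ c t = i.
  have [[x Ux cx]|nS] := pselect (S i); first by exists x.
  by exists x0 => /nS.
have [pick pickP] := choice h.
exists (pick @` S); split.
- exact/finite_image/finite_finset.
- by move=> _ [i /pickP[Ui _] <-].
- move=> x Ux; have Sx : S (c x) by exists x.
  have [Up cp] := pickP _ Sx.
  by exists (pick (c x)); [exists (c x)|exact: cP].
Qed.

(** The colour records integer parts in units of [tau], so equal colours mean values less than one
    unit apart. Adding [B] makes the values nonnegative, as truncation to a natural number
    demands. *)
Lemma finite_coloring U n (u : 'I_n -> T -> R) (B tau : R) : 0 < tau ->
  (forall i x, U x -> `|u i x| <= B) ->
  exists (C : finType) (c : T -> C), forall x y, U x -> U y -> c x = c y ->
    forall i, `|u i x - u i y| < tau.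
Proof.
move=> t0 uB; pose N := Num.truncn (2 * B / tau).
pose v i x := (u i x + B) / tau.
have v0 i x : U x -> 0 <= v i x.
  move=> Ux; apply: divr_ge0; last exact: ltW.
  have := uB i x Ux.
  by rewrite ler_norml => /andP[? ?]; lra.
have vN i x : U x -> (Num.truncn (v i x) < N.+1)%N.
  move=> Ux; rewrite ltnS; apply: le_truncn; rewrite ler_pM2r ?invr_gt0//.
  by have := uB i x Ux; rewrite ler_norml => /andP[? ?]; lra.
exists {ffun 'I_n -> 'I_N.+1}, (fun x => [ffun i => inord (Num.truncn (v i x))]).
move=> x y Ux Uy /ffunP cxy i; have := cxy i; rewrite !ffunE => /(congr1 val)/=.
rewrite !inordK ?vN// => txy.
have /andP[x1 x2] := truncn_itv (v0 i x Ux); have /andP[y1 y2] := truncn_itv (v0 i y Uy).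
have -> : u i x - u i y = (v i x - v i y) * tau.
  by rewrite /v; field; rewrite gt_eqF.
rewrite normrM (gtr0_norm t0) -[ltRHS]mul1r ltr_pM2r// ltr_norml.
by rewrite txy -!natr1 in x1 x2 y1 y2 *; apply/andP; split; lra.
Qed.

End colorings.

Lemma measurable_norm_gt (R : realType) (r : R) : measurable [set x : R | r < `|x|].
Proof.
rewrite (_ : [set _ | _] = ~` `[- r, r]%classic).
  by apply: measurableC; exact: measurable_itv.
by apply/seteqP; split => x /=; rewrite in_itv/= -ler_norml ltNge => /negP.
Qed.

(** * Sufficiency in the Kolmogorov-Riesz criterion *)

Section kolmogorov.
Context {R : realType} {k : scalar_kind} {T : Type}.
Variables (p : R) (F : T -> R -> scalar_field R k) (U : set T).
Hypotheses (p1 : 1 <= p) (mF : forall f, scalar_measurable (F f)).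
Let p0 : 0 < p. Proof. exact: lt_le_trans p1. Qed.
Let K0 : 0 < (2 : R) `^ p. Proof. by rewrite powR_gt0. Qed.

Let tail (r : R) : set R := [set x : R | r < `|x|].

Let mtail r : measurable (tail r). Proof. exact: measurable_norm_gt. Qed.

Hypothesis tails : forall eps : R, 0 < eps -> exists r : R, forall f, U f ->
  (\int[lebesgue_measure]_(x in [set x : R | (r < `|x|)%R]) emodulus_pow p (F f x) < eps%:E)%E.
Hypothesis translates : forall eps : R, 0 < eps -> exists2 rho : R, 0 < rho &
  forall f (h : R), U f -> `|h| < rho ->
  (\int[lebesgue_measure]_x emodulus_pow p (F f (x + h)%R - F f x)%R < eps%:E)%E.

Lemma integral_emodulus_le d (X : measurableType d) (mu : {measure set X -> \bar R})
    (D : set X) (G H : X -> scalar_field R k) : measurable D ->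
  scalar_measurable G -> scalar_measurable H ->
  (\int[mu]_(x in D) emodulus_pow p (G x) <= (2 `^ p)%:E *
    (\int[mu]_(x in D) emodulus_pow p (G x - H x)%R + \int[mu]_(x in D) emodulus_pow p (H x)))%E.
Proof.
move=> mD mG mH.
have E (V : X -> scalar_field R k) :
    (\int[mu]_(x in D) emodulus_pow p (V x) = \int[mu]_(x in D) emodulus_pow p (V x - 0)%R)%E.
  by apply: eq_integral => x _; rewrite subr0.
rewrite (E G) (E H); apply: integral_emodulus_triangle => //.
exact: scalar_measurable_cst.
Qed.

Let memod f : measurable_fun setT (fun x : R => emodulus_pow p (F f x)).
Proof. exact: (measurable_emodulus_pow p (mF f)). Qed.

(* If [2 r < N h], translating by [N h] sends [[-r, r]] into the tail, and [N]
   steps of length [h] bound the cost of the translation. *)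
Lemma tails_translates_bounded : exists2 M : R, 0 <= M &
  forall f, U f -> (\int[lebesgue_measure]_x emodulus_pow p (F f x) <= M%:E)%E.
Proof.
have [r hr] := tails ltr01; have [rho rho0 hrho] := translates ltr01.
pose h := rho / 2; have h0 : 0 < h by rewrite divr_gt0.
have hh : `|h| < rho by rewrite gtr0_norm// /h ltr_pdivrMr// ltr_pMr// ltr1n.
(* Each step costs at most 1, and the quasi-triangle inequality multiplies the running total by
   2^p. *)
pose B n : R := iter n (fun b => 2 `^ p * (1 + b)) 0.
have B0 n : 0 <= B n.
  by elim: n => //= n IH; apply: mulr_ge0; [exact: ltW|exact: addr_ge0].
have step n f : U f ->
    (\int[lebesgue_measure]_x emodulus_pow p (F f (x + n%:R * h)%R - F f x)%R <= (B n)%:E)%E.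
  move=> Uf; elim: n => [|n IH].
    rewrite (eq_integral (cst 0%E)) ?integral0// => x _.
    by rewrite mul0r addr0 subrr emodulus_pow0.
  have m1 := scalar_measurable_shift (n.+1%:R * h) (mF f).
  have m2 := scalar_measurable_shift (n%:R * h) (mF f).
  apply: le_trans (integral_emodulus_triangle p1 lebesgue_measure measurableT m1 m2 (mF f)) _.
  rewrite /= EFinM; apply: lee_wpmul2l; first by rewrite lee_fin ltW.
  rewrite EFinD; apply: leeD; last exact: IH.
  rewrite (eq_integral (fun x : measurableTypeR R =>
    emodulus_pow p (F f (x + n%:R * h + h) - F f (x + n%:R * h)))); last first.
    by move=> x _; rewrite -natr1 mulrDl mul1r addrA.
  rewrite (@integral_translate2 R p k (fun x => F f (x + h)) (F f) (n%:R * h)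
    (scalar_measurable_shift h (mF f)) (mF f)).
  exact: ltW (hrho f h Uf hh).
have [N hN] : exists N : nat, 2 * `|r| < N%:R * h.
  exists (Num.truncn (2 * `|r| / h)).+1; rewrite -ltr_pdivrMr//.
  exact: truncnS_gt.
exists (1 + 2 `^ p * (B N + 1)) => [|f Uf].
  by apply: addr_ge0 => //; apply: mulr_ge0; [exact: ltW|exact: addr_ge0].
have mNh := scalar_measurable_shift (N%:R * h) (mF f).
rewrite -(setUv (tail r)) ge0_integral_setU; last 5 first.
- exact: mtail.
- exact: (measurableC (mtail r)).
- exact: (measurable_funTS (memod f)).
- by move=> x _; exact: emodulus_pow_ge0.
- by rewrite disj_set2E setICr.
rewrite EFinD; apply: leeD; first exact: ltW (hr f Uf).
apply: le_trans (integral_emodulus_le lebesgue_measure (measurableC (mtail r)) (mF f) mNh) _.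
rewrite EFinM; apply: lee_wpmul2l; first by rewrite lee_fin ltW.
rewrite EFinD; apply: leeD.
  rewrite (eq_integral (fun x : measurableTypeR R =>
    emodulus_pow p (F f (x + N%:R * h) - F f x))); last first.
    by move=> x _; rewrite emodulus_powB.
  apply: le_trans (step N f Uf); apply: ge0_subset_integral => //.
  - exact: (measurableC (mtail r)).
  - exact: (measurable_emodulus_pow p (scalar_measurableB mNh (mF f))).
apply: le_trans (ltW (hr f Uf)).
rewrite -(@integral_shift R (N%:R * h) _ _ (mtail r) (memod f) (fun=> emodulus_pow_ge0 _ _)).
apply: ge0_subset_integral.
- exact: (measurableC (mtail r)).
- exact: measurable_shift_preimage.
- exact: (measurable_funTS (measurable_emodulus_pow p mNh)).
- by move=> x _; exact: emodulus_pow_ge0.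
- move=> x; rewrite /tail/= => /negP; rewrite -leNgt => xr.
  have rr := ler_norm r.
  apply: lt_le_trans (ler_norm _).
  by move: xr; rewrite ler_norml => /andP[xr _]; lra.
Qed.

Let step_diff f g D (c1 c2 : scalar_field R k) : measurable D ->
  (\int[lebesgue_measure]_(x in D) emodulus_pow p (F f x - F g x)%R <=
   (2 `^ p)%:E * (\int[lebesgue_measure]_(x in D) emodulus_pow p (F f x - c1)%R +
   (2 `^ p)%:E * (emodulus_pow p (c1 - c2)%R * lebesgue_measure D +
     \int[lebesgue_measure]_(x in D) emodulus_pow p (F g x - c2)%R)))%E.
Proof.
move=> mD.
have mc (c : scalar_field R k) : scalar_measurable (fun _ : R => c).
  exact: scalar_measurable_cst.
apply: le_trans (integral_emodulus_triangle p1 lebesgue_measure mD (mF f) (mc c1) (mF g)) _.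
apply: lee_wpmul2l; first by rewrite lee_fin ltW.
apply: leeD2l.
apply: le_trans (integral_emodulus_triangle p1 lebesgue_measure mD (mc c1) (mc c2) (mF g)) _.
apply: lee_wpmul2l; first by rewrite lee_fin ltW.
apply: leeD.
  by rewrite le_eqVlt; apply/orP; left; apply/eqP; exact: integral_cst.
rewrite le_eqVlt; apply/orP; left; apply/eqP.
by apply: eq_integral => x _; rewrite emodulus_powB.
Qed.

(** Integrating the constant [F f z] over [D] bounds its p-th power. No root is taken: a number is
    at most 1 or at most its p-th power, whence the leading [1]. *)
Lemma value_bound f (D : set R) (delta c M : R) z : measurable D ->
  lebesgue_measure D = delta%:E -> 0 < delta ->
  (\int[lebesgue_measure]_x emodulus_pow p (F f x) <= M%:E)%E ->
  (\int[lebesgue_measure]_(x in D) emodulus_pow p (F f x - F f z)%R <= c%:E)%E ->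
  modulus (F f z) <= 1 + 2 `^ p * (c + M) / delta.
Proof.
move=> mD Dd d0 fM fc.
have mc : scalar_measurable (fun _ : R => F f z) by exact: scalar_measurable_cst.
have : (emodulus_pow p (F f z) * lebesgue_measure D <= (2 `^ p * (c + M))%:E)%E.
  rewrite -[X in (X <= _)%E](integral_cst lebesgue_measure mD (emodulus_pow p (F f z))).
  apply: le_trans (integral_emodulus_le lebesgue_measure mD mc (mF f)) _.
  rewrite EFinM; apply: lee_wpmul2l; first by rewrite lee_fin ltW.
  rewrite EFinD; apply: leeD.
    apply: le_trans fc; rewrite le_eqVlt; apply/orP; left; apply/eqP.
    by apply: eq_integral => x _; rewrite emodulus_powB.
  apply: le_trans fM; apply: ge0_subset_integral => //; exact: memod.
rewrite Dd -EFinM lee_fin -ler_pdivlMr// => h.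
have [z1|z1] := leP (modulus (F f z)) 1.
  by rewrite (le_trans z1)// lerDl (le_trans _ h)// powR_ge0.
apply: (@le_trans _ _ (modulus (F f z) `^ p)).
  by rewrite -[leLHS]powRr1 ?modulus_ge0// ler_powR// ltW.
by rewrite (le_trans h)// lerDr.
Qed.

Lemma kolmogorov_colorable : finitely_colorable
  (fun f g => \int[lebesgue_measure]_x emodulus_pow p (F f x - F g x)%R)%E U.
Proof.
move=> e e0; pose K := (2 : R) `^ p.
(* The errors add up to 5 K eta + 4 K^2 eta: 3 K and 4 K^2 from the cells, 2 K from outside. One
   more of each makes the inequality strict. *)
pose eta := e / (6 * K + 5 * (K * K)); have eta0 : 0 < eta.
  by rewrite divr_gt0// addr_gt0// !mulr_gt0.
have [M M0 hM] := tails_translates_bounded.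
have [r0 hr0] := tails eta0; have [delta d0 hdelta] := translates eta0.
(* Condition 3 may supply a nonpositive radius. With [r] positive, [n] cells of length [delta]
   starting at [- r] reach beyond [r]. *)
pose r := Num.max r0 1; have rgt0 : 0 < r by rewrite lt_max ltr01 orbT.
pose n := (Num.truncn (2 * r / delta)).+1.
have nr : 2 * r < n%:R * delta by rewrite -ltr_pdivrMr//; exact: truncnS_gt.
have /choice[z zP] : forall f, exists z : 'I_n -> R, U f ->
    (\sum_(j < n) \int[lebesgue_measure]_(x in cell (- r) delta j)
       emodulus_pow p (F f x - F f (z j))%R <= (3 * eta)%:E)%E.
  move=> f; have [Uf|nU] := pselect (U f); last by exists (fun=> 0) => /nU.
  have [z hz] := sampling (- r) n d0 eta0 (mF f)
    (fun h hh => ltW (hdelta f h Uf hh)).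
  by exists z.
pose v f (j : 'I_n) := F f (z f j).
pose B := 1 + 2 `^ p * (3 * eta + M) / delta.
have vB f j : U f -> modulus (v f j) <= B.
  move=> Uf; apply: (value_bound (measurable_cell (- r) delta j)
    (lebesgue_measure_cell (- r) j d0) d0 (hM f Uf)).
  apply: le_trans (zP f Uf); rewrite (bigD1 j)//= leeDl// sume_ge0// => i _.
  by apply: integral_ge0 => x _; exact: emodulus_pow_ge0.
(* Sampled values will differ by at most [2 * tau]. The first entry makes this at most 1, hence an
   upper bound of its own p-th power; the second makes each of the [n] cells cost at most
   [eta / n]. *)
pose tau := Num.min (1 / 2) (eta / (2 * (n%:R * delta))).
have nd0 : 0 < n%:R * delta by rewrite mulr_gt0// ltr0n.
have tau0 : 0 < tau by rewrite lt_min; apply/andP; split; apply: divr_gt0 => //; apply: mulr_gt0.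
have [C1 [c1 c1P]] := finite_coloring (u := fun j f => scalar_re (v f j)) tau0
  (fun j f Uf => le_trans (modulus_re _) (vB f j Uf)).
have [C2 [c2 c2P]] := finite_coloring (u := fun j f => scalar_im (v f j)) tau0
  (fun j f Uf => le_trans (modulus_im _) (vB f j Uf)).
exists (C1 * C2)%type, (fun f => (c1 f, c2 f)) => f g Uf Ug [c1fg c2fg].
have vfg j : (emodulus_pow p (v f j - v g j)%R * lebesgue_measure (cell (- r) delta j) <=
    (eta / n%:R)%:E)%E.
  rewrite lebesgue_measure_cell// -EFinM lee_fin -ler_pdivlMr//.
  have m2 : modulus (v f j - v g j) <= 2 * tau.
    apply: le_trans (modulus_le_reim _) _; rewrite scalar_reB scalar_imB.
    have := c1P f g Uf Ug c1fg j; have := c2P f g Uf Ug c2fg j; lra.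
  have tau1 : 2 * tau <= 1.
    have : tau <= 1 / 2 by rewrite ge_min lexx.
    lra.
  apply: (@le_trans _ _ (2 * tau)).
    apply: (@le_trans _ _ ((2 * tau) `^ p)).
      by rewrite ge0_ler_powR ?nnegrE ?modulus_ge0 ?mulr_ge0// ltW.
    rewrite -[leRHS]powRr1 ?mulr_ge0 ?(ltW tau0)//.
    by apply: ger_powR => //; rewrite tau1 mulr_gt0.
  have tau2 : tau <= eta / (2 * (n%:R * delta)) by rewrite ge_min lexx orbT.
  apply: (@le_trans _ _ (2 * (eta / (2 * (n%:R * delta))))); first by rewrite ler_pM2l.
  rewrite le_eqVlt; apply/orP; left; apply/eqP; field.
  by rewrite (gt_eqF d0) /= pnatr_eq0.
pose D : set R := `[(- r)%R, (- r + n%:R * delta)%R[%classic.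
have mD : measurable D by exact: measurable_itv.
have mFfg := measurable_emodulus_pow p (scalar_measurableB (mF f) (mF g)).
have tailD h : U h ->
    (\int[lebesgue_measure]_(x in ~` D) emodulus_pow p (F h x - 0)%R <= eta%:E)%E.
  move=> Uh.
  rewrite (eq_integral (fun x : measurableTypeR R => emodulus_pow p (F h x))); last first.
    by move=> x _; rewrite subr0.
  apply: le_trans (ltW (hr0 h Uh)); apply: ge0_subset_integral.
  - exact: (measurableC mD).
  - exact: mtail.
  - exact: (measurable_funTS (memod h)).
  - by move=> x _; exact: emodulus_pow_ge0.
  - move=> x; rewrite /D/= in_itv/= => /negP; rewrite negb_and -ltNge -leNgt => xD.
    apply: le_lt_trans (_ : r0 <= r) _; first by rewrite le_max lexx.
    by rewrite ltNge ler_norml negb_and -!ltNge; case/orP: xD => xD; apply/orP; [left|right; lra].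
have mc0 : scalar_measurable (fun _ : R => 0 : scalar_field R k).
  exact: scalar_measurable_cst.
have outD : (\int[lebesgue_measure]_(x in ~` D) emodulus_pow p (F f x - F g x)%R <=
    (K * (eta + eta))%:E)%E.
  apply: le_trans (integral_emodulus_triangle p1 lebesgue_measure (measurableC mD)
    (mF f) mc0 (mF g)) _.
  rewrite EFinM; apply: lee_wpmul2l; first by rewrite lee_fin ltW.
  rewrite EFinD; apply: leeD; first exact: tailD.
  apply: le_trans (tailD g Ug); rewrite le_eqVlt; apply/orP; left; apply/eqP.
  by apply: eq_integral => x _; rewrite emodulus_powB.
have inD : (\int[lebesgue_measure]_(x in D) emodulus_pow p (F f x - F g x)%R <=
    (K * (3 * eta + K * (eta + 3 * eta)))%:E)%E.
  rewrite -(integral_cells _ _ d0 mFfg) => [|x]; last exact: emodulus_pow_ge0.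
  apply: le_trans (lee_sum _ (fun j _ => step_diff f g (v f j) (v g j) (measurable_cell _ _ _))) _.
  have i0 h (j : 'I_n) : (0 <= \int[lebesgue_measure]_(x in cell (- r) delta j)
      emodulus_pow p (F h x - v h j)%R)%E.
    by apply: integral_ge0 => x _; exact: emodulus_pow_ge0.
  have v0 (j : 'I_n) : (0 <= emodulus_pow p (v f j - v g j)%R *
      lebesgue_measure (cell (- r) delta j))%E.
    by apply: mule_ge0 => //; exact: emodulus_pow_ge0.
  have K0' : (0 <= K%:E)%E by rewrite lee_fin ltW.
  rewrite -ge0_sume_distrr => [|j _]; last first.
    by apply: adde_ge0; [exact: i0|apply: mule_ge0 => //; apply: adde_ge0; [exact: v0|exact: i0]].
  rewrite EFinM; apply: lee_wpmul2l; first exact: K0'.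
  rewrite big_split EFinD; apply: leeD; first exact: zP f Uf.
  rewrite -ge0_sume_distrr => [|j _]; last by apply: adde_ge0; [exact: v0|exact: i0].
  rewrite EFinM; apply: lee_wpmul2l; first exact: K0'.
  rewrite big_split EFinD; apply: leeD; last exact: zP g Ug.
  apply: le_trans (lee_sum _ (fun j _ => vfg j)) _.
  rewrite sumEFin lee_fin sumr_const card_ord -[X in X <= _]mulr_natr divfK//.
  by rewrite pnatr_eq0.
have -> : (\int[lebesgue_measure]_x emodulus_pow p (F f x - F g x)%R =
    \int[lebesgue_measure]_(x in D) emodulus_pow p (F f x - F g x)%R +
    \int[lebesgue_measure]_(x in ~` D) emodulus_pow p (F f x - F g x)%R)%E.
  rewrite -ge0_integral_setU; last 5 first.
  - exact: mD.
  - exact: (measurableC mD).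
  - exact: (measurable_funTS mFfg).
  - by move=> x _; exact: emodulus_pow_ge0.
  - by rewrite disj_set2E setICr.
  by rewrite setUv.
apply: le_lt_trans (leeD inD outD) _; rewrite -EFinD lte_fin.
have KK : 0 < 6 * K + 5 * (K * K) by rewrite addr_gt0// !mulr_gt0.
have <- : (6 * K + 5 * (K * K)) * eta = e by rewrite /eta mulrC divfK// gt_eqF.
have := mulr_gt0 K0 eta0; have := mulr_gt0 (mulr_gt0 K0 K0) eta0; rewrite -/K; lra.
Qed.

End kolmogorov.

(** * Weighted sums *)

Lemma near_finite_set {X : Type} {T : choiceType} (F : set_system X) {FF : Filter F}
    (C : set T) (P : T -> X -> Prop) : finite_set C ->
  (forall c, C c -> \forall x \near F, P c x) ->
  \forall x \near F, forall c, C c -> P c x.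
Proof.
move=> /finite_seqP[s ->] sP.
suff : \forall x \near F, {in s, forall c, P c x} by [].
elim: s sP => [|c s IH] sP; first exact: nearW.
have Pc : \forall x \near F, P c x by apply: sP; rewrite /= inE eqxx.
have Ps : \forall x \near F, {in s, forall c, P c x}.
  by apply: IH => c' cs; apply: sP; rewrite /= inE cs orbT.
by near=> x => c'; rewrite inE => /orP[/eqP->|]; [near: x|move: c'; near: x].
Unshelve. all: by end_near.
Qed.

(** The common form of the necessity of conditions 2, 3 and 4: [S] is small near the limit for each
    centre of a net, hence for all of its finitely many centres at once, and nearby elements inherit
    this. The filter is [\oo] for the tails and the neighbourhoods of 0 for the translations. *)
Lemma totally_bounded_near (R : realType) (T : choiceType) (X : Type)
    (F : set_system X) {FF : Filter F} (dist : T -> T -> \bar R) (U : set T)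
    (S : X -> T -> \bar R) (L : R) : 0 < L -> totally_bounded dist U ->
  (forall x f c, U f -> U c -> (S x f <= L%:E * (dist c f + S x c))%E) ->
  (forall c, U c -> forall e : R, 0 < e -> \forall x \near F, (S x c < e%:E)%E) ->
  forall e : R, 0 < e -> \forall x \near F, forall f, U f -> (S x f < e%:E)%E.
Proof.
move=> L0 tb SL Slim e e0; have eL : 0 < e / (L * 2) by rewrite divr_gt0// mulr_gt0.
have [C [finC CU UC]] := tb _ eL.
have : \forall x \near F, forall c, C c -> (S x c < (e / (L * 2))%:E)%E.
  by apply: near_finite_set => // c /CU Uc; exact: Slim.
apply: filterS => x Sx f Uf; have [c Cc cf] := UC f Uf.
apply: le_lt_trans (SL x f c Uf (CU c Cc)) _.
by apply: lteeM_add => //; exact: Sx.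
Qed.

Section weighted_sums.
Context {R : realType} {k : scalar_kind}.
Variables (p : R) (I : set nat) (w : nat -> R).
Hypotheses (p1 : 1 <= p) (w0 : forall i, I i -> 0 <= w i).
Let p0 : 0 < p. Proof. exact: lt_le_trans p1. Qed.

Definition weighted_pow (D : set nat) (u v : nat -> scalar_field R k) :=
  (\esum_(i in D) (emodulus_pow p (u i - v i)%R * (w i)%:E))%E.

Lemma weighted_pow_term_ge0 (u v : nat -> scalar_field R k) i : I i ->
  (0 <= emodulus_pow p (u i - v i)%R * (w i)%:E)%E.
Proof.
by move=> Ii; apply: mule_ge0; [exact: emodulus_pow_ge0|rewrite lee_fin; exact: w0].
Qed.

Lemma weighted_pow_triangle D u v z : D `<=` I ->
  (weighted_pow D u z <= (2 `^ p)%:E * (weighted_pow D u v + weighted_pow D v z))%E.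
Proof.
move=> DI; rewrite /weighted_pow -esumD; last 2 first.
- by move=> i /DI; exact: weighted_pow_term_ge0.
- by move=> i /DI; exact: weighted_pow_term_ge0.
set a := (fun i => emodulus_pow p (u i - v i) * (w i)%:E +
  emodulus_pow p (v i - z i) * (w i)%:E)%E.
have a0 i : D i -> (0 <= a i)%E.
  by move=> /DI Ii; apply: adde_ge0; exact: weighted_pow_term_ge0.
have <- : (\esum_(i in D) ((2 `^ p)%:E * a i) = (2 `^ p)%:E * \esum_(i in D) a i)%E.
  rewrite -[in LHS](set_mem_set D) -[in RHS](set_mem_set D) -!nneseries_esum; last 2 first.
  - by move=> i; rewrite inE; exact: a0.
  - by move=> i; rewrite inE => /a0 ai; rewrite mule_ge0// lee_fin powR_ge0.
  by rewrite nneseriesZl// => i; rewrite inE; exact: a0.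
apply: le_esum => i /DI Ii; rewrite /a -muleDl ?muleA; last 2 first.
- by [].
- by rewrite ge0_adde_def// inE; exact: emodulus_pow_ge0.
apply: lee_wpmul2r; first by rewrite lee_fin; exact: w0.
exact: emodulus_pow_triangle.
Qed.

Lemma weighted_pow_tail u v : (weighted_pow I u v < +oo)%E ->
  forall e : R, 0 < e ->
  \forall n \near \oo, (weighted_pow (I `&` [set i | (n < i)%N]) u v < e%:E)%E.
Proof.
move=> uv e e0; pose P i := i \in I.
have a0 i : P i -> (0 <= emodulus_pow p (u i - v i) * (w i)%:E)%E.
  by rewrite /P inE; exact: weighted_pow_term_ge0.
have lty : (\sum_(0 <= i <oo | P i) (emodulus_pow p (u i - v i)%R * (w i)%:E) < +oo)%E.
  by rewrite nneseries_esum// set_mem_set.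
have : nbhs 0%E [set y : \bar R | (y < e%:E)%E].
  by apply: open_nbhs_nbhs; split; [exact: open_ereal_lt_ereal|rewrite /= lte_fin].
move=> /(nneseries_tail_cvg lty a0)[N _ hN]; exists N => // n /= Nn.
(* The remainder that starts at [n.+1] is the sum over [n < i]. *)
have /= := hN n.+1 (leq_trans Nn (leqnSn n)).
rewrite eseries_cond nneseries_esum => [|i /andP[/a0//]].
rewrite /weighted_pow; set A := (X in (\esum_(i in X) _ < _)%E -> _).
suff -> : I `&` [set i | (n < i)%N] = A by [].
apply/seteqP; split => i; rewrite /A /P/=; first by move=> [Ii ->]; rewrite mem_set.
by move=> /andP[/set_mem].
Qed.

(** Colours discretise the values at the indices up to [n]; the remaining indices are controlled
    uniformly by the tail condition. *)
Lemma weighted_pow_colorable T (U : set T) (u : T -> nat -> scalar_field R k) :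
  (forall i, I i -> exists M, forall f, U f -> modulus (u f i) <= M) ->
  (forall e : R, 0 < e -> exists n, forall f, U f ->
    (weighted_pow (I `&` [set i | (n < i)%N]) (u f) (fun=> 0%R) < e%:E)%E) ->
  finitely_colorable (fun f h => weighted_pow I (u f) (u h)) U.
Proof.
move=> bnd tl e e0; pose K := (2 : R) `^ p; have K0 : 0 < K by rewrite powR_gt0.
(* The tail costs 2 K eta and the head [eta]; the spare [eta] makes the inequality strict. *)
pose eta := e / (2 * K + 2); have K2 : 0 < 2 * K + 2 by lra.
have eta0 : 0 < eta by rewrite divr_gt0.
have [n hn] := tl _ eta0.
have /choice[M hM] : forall i, exists M, I i -> forall f, U f -> modulus (u f i) <= M.
  move=> i; have [/bnd[M hM]|nI] := pselect (I i); first by exists M.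
  by exists 0 => /nI.
(* An index up to [n] may lie outside [I], where nothing bounds the values; there they are replaced
   by 0. *)
pose v (j : 'I_n.+1) f : scalar_field R k := if (j : nat) \in I then u f j else 0.
pose B := \sum_(j < n.+1) `|M j|.
have vB j f : U f -> modulus (v j f) <= B.
  move=> Uf; apply: (@le_trans _ _ `|M j|).
    rewrite /v; case: ifPn => [/set_mem Ij|_]; last by rewrite modulus0.
    by rewrite (le_trans (hM j Ij f Uf))// ler_norm.
  by rewrite /B (bigD1 j)//= lerDl sumr_ge0.
pose W := \sum_(j < n.+1) `|w j|; have W0 : 0 <= W by exact: sumr_ge0.
(* As in the Kolmogorov criterion, [2 * tau] bounds its own p-th power, and times the total weight
   [W] it stays below [eta]; [W] may be zero, hence [W + 1]. *)
pose tau := Num.min (1 / 2) (eta / (2 * (W + 1))).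
have W1 : 0 < W + 1 by lra.
have tau0 : 0 < tau.
  by rewrite lt_min; apply/andP; split; apply: divr_gt0 => //; apply: mulr_gt0.
have [C1 [c1 c1P]] := finite_coloring (u := fun j f => scalar_re (v j f)) tau0
  (fun j f Uf => le_trans (modulus_re _) (vB j f Uf)).
have [C2 [c2 c2P]] := finite_coloring (u := fun j f => scalar_im (v j f)) tau0
  (fun j f Uf => le_trans (modulus_im _) (vB j f Uf)).
exists (C1 * C2)%type, (fun f => (c1 f, c2 f)) => f g Uf Ug [c1fg c2fg].
have tl0 : I `&` [set i | (n < i)%N] `<=` I by exact: subIsetl.
have far : (weighted_pow (I `&` [set i | (n < i)%N]) (u f) (u g) <= (K * (eta + eta))%:E)%E.
  apply: le_trans (weighted_pow_triangle (u f) (fun=> 0) (u g) tl0) _.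
  rewrite EFinM; apply: lee_wpmul2l; first by rewrite lee_fin ltW.
  rewrite EFinD; apply: leeD; first exact: ltW (hn f Uf).
  apply: le_trans (ltW (hn g Ug)); apply: le_esum => i [Ii _].
  by rewrite emodulus_powB.
have near_ : (weighted_pow (I `&` ~` [set i | (n < i)%N]) (u f) (u g) <= eta%:E)%E.
  have -> : I `&` ~` [set i | (n < i)%N] = `I_n.+1 `&` I.
    rewrite setIC; congr (_ `&` _); apply/seteqP; split => i /=.
      by move/negP; rewrite -leqNgt.
    by rewrite ltnS leqNgt => /negP.
  rewrite /weighted_pow esum_mkcondr esum_fset; last 2 first.
  - exact: finite_II.
  - by move=> i _; case: ifPn => // /set_mem; exact: weighted_pow_term_ge0.
  rewrite -fsbig_ord /=.
  apply: (@le_trans _ _ (\sum_(j < n.+1) (2 * tau * `|w j|)%:E)%E).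
    apply: lee_sum => j _; case: ifPn => [jI|_]; last first.
      by rewrite lee_fin mulr_ge0// mulr_ge0// ltW.
    have m2 : modulus (u f j - u g j) <= 2 * tau.
      apply: le_trans (modulus_le_reim _) _; rewrite scalar_reB scalar_imB.
      have := c1P f g Uf Ug c1fg j; have := c2P f g Uf Ug c2fg j; rewrite /v jI; lra.
    have tau1 : 2 * tau <= 1.
      have : tau <= 1 / 2 by rewrite ge_min lexx.
      lra.
    rewrite -EFinM lee_fin; apply: ler_pM; [exact: powR_ge0|exact/w0/set_mem| |exact: ler_norm].
    apply: (@le_trans _ _ ((2 * tau) `^ p)).
      by rewrite ge0_ler_powR ?nnegrE ?modulus_ge0 ?mulr_ge0// ltW.
    rewrite -[leRHS]powRr1 ?mulr_ge0 ?(ltW tau0)//.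
    by apply: ger_powR => //; rewrite tau1 mulr_gt0.
  rewrite sumEFin lee_fin -mulr_sumr -/W.
  have tau2 : tau <= eta / (2 * (W + 1)) by rewrite ge_min lexx orbT.
  apply: (@le_trans _ _ (2 * (eta / (2 * (W + 1))) * (W + 1))).
    by apply: ler_pM; rewrite ?mulr_ge0 ?(ltW tau0) ?ler_pM2l//; lra.
  rewrite le_eqVlt; apply/orP; left; apply/eqP; field.
  by rewrite gt_eqF.
have -> : weighted_pow I (u f) (u g) =
    (weighted_pow (I `&` [set i | (n < i)%N]) (u f) (u g) +
     weighted_pow (I `&` ~` [set i | (n < i)%N]) (u f) (u g))%E.
  by apply: esumID => i; exact: weighted_pow_term_ge0.
apply: le_lt_trans (leeD far near_) _; rewrite -EFinD lte_fin.
have <- : (2 * K + 2) * eta = e by rewrite /eta mulrC divfK// gt_eqF.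
by lra.
Qed.

End weighted_sums.

(** * Total boundedness in the Stieltjes Lebesgue space *)

Lemma finitely_colorableD (R : realType) (T : Type) (dist1 dist2 : T -> T -> \bar R)
    (U : set T) : finitely_colorable dist1 U -> finitely_colorable dist2 U ->
  finitely_colorable (fun x y => dist1 x y + dist2 x y)%E U.
Proof.
move=> col1 col2 e e0; have e2 : 0 < e / 2 by rewrite divr_gt0.
have [C1 [c1 c1P]] := col1 _ e2; have [C2 [c2 c2P]] := col2 _ e2.
exists (C1 * C2)%type, (fun x => (c1 x, c2 x)) => x y Ux Uy [c1xy c2xy].
by rewrite [e]splitr EFinD; apply: lteD; [exact: c1P|exact: c2P].
Qed.

(** The conditions have thresholds of the form eps^p; with eps = e^(1/p) these are all positive
    numbers. *)
Lemma powRVK (R : realType) (p e : R) : 0 < p -> 0 < e -> (e `^ p^-1) `^ p = e.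
Proof. by move=> p0 e0; rewrite -powRrM mulVf ?powRr1 ?ltW// gt_eqF. Qed.

(** Dominated convergence: at a fixed [x] the restrictions of [f] to the tails vanish once n is at
    least |x|. *)
Lemma integral_tail_cvg (R : realType) (f : R -> \bar R) : measurable_fun setT f ->
  (forall x, 0 <= f x)%E -> (\int[lebesgue_measure]_x f x < +oo)%E ->
  forall e : R, 0 < e ->
  \forall n \near \oo, (\int[lebesgue_measure]_(x in [set x : R | (n%:R < `|x|)%R]) f x < e%:E)%E.
Proof.
move=> mf f0 flty e e0; pose D (n : nat) : set R := [set x : R | n%:R < `|x|].
have mD n : measurable (D n) by exact: measurable_norm_gt.
have f_ge0 n x : (0 <= (f \_ (D n)) x)%E by rewrite patchE; case: ifP.
have fi : lebesgue_measure.-integrable setT f.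
  apply/integrableP; split; first exact: mf.
  rewrite (eq_integral (fun x : measurableTypeR R => f x)); first exact: flty.
  by move=> x _; exact: gee0_abs.
have mfn n : measurable_fun setT (f \_ (D n)).
  exact: (proj1 (measurable_restrictT f (mD n)) (measurable_funTS mf)).
have [||_ _ cv] := @dominated_convergence _ (measurableTypeR R) R lebesgue_measure setT
    measurableT (fun n => f \_ (D n)) (cst 0%E) f mfn (measurable_cst _) _ fi _.
- apply: aeW => x _; apply: cvg_near_cst; near=> n; rewrite patchE memNset// /D/=.
  by apply/negP; rewrite -leNgt; near: n; exact: nbhs_infty_ger.
- by apply: aeW => x n _; rewrite gee0_abs// patchE; case: ifP.
rewrite integral0 in cv.
have : nbhs 0%E [set y : \bar R | (y < e%:E)%E].
  by apply: open_nbhs_nbhs; split; [exact: open_ereal_lt_ereal|rewrite /= lte_fin].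
move=> /cv[N _ hN]; exists N => // n Nn.
by have := hN n Nn; rewrite /= -integral_mkcond.
Unshelve. all: by end_near.
Qed.

Section assembly.
Context {R : realType} {k : scalar_kind}.
Variables (g : derivator R) (p : R) (I : set nat) (d : nat -> R) (G : set (mfun_class k g)).
Hypothesis nconst : forall t, ~ exists c, forall s, s <= t -> cont_part g s = c.
Hypothesis p1 : 1 <= p.
Hypothesis dE : set_bij I (jump_set g) d.
Hypothesis GLp : G `<=` Lp_set p.
Variable V : mfun_class k g -> R -> scalar_field R k.
Hypothesis hV : forall f, borel_version g (class_fun f) (V f).
Let p0 : 0 < p. Proof. exact: lt_le_trans p1. Qed.
Let K0 : 0 < (2 : R) `^ p. Proof. by rewrite powR_gt0. Qed.

Let val_jump (f : mfun_class k g) i := class_fun f (d i).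
Let weight i := jump g (d i).
Let cont f := comp_pseudoinverse g (V f).

Let weight0 i : I i -> 0 <= weight i.
Proof. by have [dI _ _] := dE => /dI/ltW. Qed.

Let mcont f : scalar_measurable (cont f).
Proof. exact: (scalar_measurable_pseudoinverse dE nconst (hV f).1). Qed.

Let dist_pow (f h : mfun_class k g) : \bar R :=
  (\int[stieltjes g]_x emodulus_pow p (class_fun f x - class_fun h x)%R)%E.

Let dist_powE f h : (dist_pow f h = weighted_pow p weight I (val_jump f) (val_jump h) +
  \int[lebesgue_measure]_x emodulus_pow p (cont f x - cont h x)%R)%E.
Proof.
exact: (integral_stieltjes_version dE nconst p1 (class_fun_measurable f)
  (class_fun_measurable h) (hV f) (hV h)).
Qed.

(** [dist_pow] obeys the triangle inequality only up to 2^p, but its balls are those of [Lp_dist]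
    with radii raised to the power [p]. *)
Let totally_bounded_dist_pow :
  totally_bounded (Lp_dist p) G <-> totally_bounded dist_pow G.
Proof.
split=> tb e e0.
  have [|C [finC CG GC]] := tb (e `^ p^-1); first by rewrite powR_gt0.
  exists C; split => // f Gf; have [c Cc /=] := GC f Gf.
  by rewrite (Lp_dist_lt p1) ?powR_gt0// powRVK// => cf; exists c.
have [|C [finC CG GC]] := tb (e `^ p); first by rewrite powR_gt0.
exists C; split => // f Gf; have [c Cc cf] := GC f Gf.
by exists c => //=; rewrite (Lp_dist_lt p1).
Qed.

Let tail_jumpE n f :
  (\esum_(i in I `&` [set i | (n < i)%N]) (modulus (class_fun f (d i)) `^ p * jump g (d i))%:E)%E =
  weighted_pow p weight (I `&` [set i | (n < i)%N]) (val_jump f) (fun=> 0).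
Proof. by apply: eq_esum => i _; rewrite subr0 EFinM. Qed.

Let tail_contE (r : R) f :
  (\int[completed_lebesgue_measure]_(x in [set x : R | (r < `|x|)%R])
     (modulus (comp_pseudoinverse g (class_fun f) x) `^ p)%:E =
   \int[lebesgue_measure]_(x in [set x : R | (r < `|x|)%R]) emodulus_pow p (cont f x))%E.
Proof.
exact: (integral_completed_comp_pseudoinverse dE nconst p (measurable_norm_gt r) (hV f)).
Qed.

Let translate_contE (h : R) f :
  (\int[completed_lebesgue_measure]_x
     (modulus (comp_pseudoinverse g (class_fun f) (x + h)
               - comp_pseudoinverse g (class_fun f) x) `^ p)%:E =
   \int[lebesgue_measure]_x emodulus_pow p (cont f (x + h)%R - cont f x)%R)%E.
Proof. exact: (integral_completed_translate dE nconst p h (hV f)). Qed.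

Lemma totally_bounded_of_conditions :
  (forall n, I n -> exists M : R, forall f, G f -> modulus (class_fun f (d n)) <= M) ->
  (forall eps : R, 0 < eps -> exists n : nat, forall f, G f ->
        (\esum_(i in I `&` [set i | (n < i)%N])
            (modulus (class_fun f (d i)) `^ p * jump g (d i))%:E
          < (eps `^ p)%:E)%E) ->
  (forall eps : R, 0 < eps -> exists r : R, forall f, G f ->
        (\int[completed_lebesgue_measure]_(x in [set x : R | (r < `|x|)%R])
            (modulus (comp_pseudoinverse g (class_fun f) x) `^ p)%:E
          < (eps `^ p)%:E)%E) ->
  (forall eps : R, 0 < eps -> exists2 rho : R, 0 < rho &
        forall f (h : R), G f -> `|h| < rho ->
        (\int[completed_lebesgue_measure]_x
            (modulus (comp_pseudoinverse g (class_fun f) (x + h)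
                      - comp_pseudoinverse g (class_fun f) x) `^ p)%:E
          < (eps `^ p)%:E)%E) ->
  totally_bounded (Lp_dist p) G.
Proof.
move=> bnd tailj tailc trans; apply/totally_bounded_dist_pow.
apply: finitely_colorable_totally_bounded.
have -> : dist_pow = (fun f h => weighted_pow p weight I (val_jump f) (val_jump h) +
    \int[lebesgue_measure]_x emodulus_pow p (cont f x - cont h x)%R)%E.
  by apply/funext => f; apply/funext => h; exact: dist_powE.
have root e : 0 < e -> 0 < e `^ p^-1 by move=> e0; rewrite powR_gt0.
apply: finitely_colorableD.
  apply: (weighted_pow_colorable p1 weight0) => // e e0.
  have [n hn] := tailj _ (root e e0); exists n => f Gf.
  by have := hn f Gf; rewrite powRVK// tail_jumpE.
apply: (kolmogorov_colorable p1 mcont) => e e0.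
  have [r hr] := tailc _ (root e e0); exists r => f Gf.
  by have := hr f Gf; rewrite powRVK// tail_contE.
have [rho rho0 hrho] := trans _ (root e e0); exists rho => // f h Gf hh.
by have := hrho f h Gf hh; rewrite powRVK// translate_contE.
Qed.

Let jump_le_dist_pow f h :
  (weighted_pow p weight I (val_jump f) (val_jump h) <= dist_pow f h)%E.
Proof.
rewrite dist_powE leeDl//; apply: integral_ge0 => x _; exact: emodulus_pow_ge0.
Qed.

Let cont_le_dist_pow f h :
  (\int[lebesgue_measure]_x emodulus_pow p (cont f x - cont h x)%R <= dist_pow f h)%E.
Proof.
by rewrite dist_powE leeDr//; apply: esum_ge0 => i; exact: (weighted_pow_term_ge0 p weight0).
Qed.

Let dist_powC f h : dist_pow f h = dist_pow h f.
Proof. by apply: eq_integral => x _; rewrite emodulus_powB. Qed.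

Let Lp_split f : G f -> (weighted_pow p weight I (val_jump f) (fun=> 0%R) < +oo)%E /\
  (\int[lebesgue_measure]_x emodulus_pow p (cont f x) < +oo)%E.
Proof.
move=> /GLp/(Lp_set_lt p1).
have m0 : scalar_measurable ((fun=> 0) : caratheodory_type (stieltjes_outer g) -> scalar_field R k).
  exact: scalar_measurable_cst.
rewrite (integral_stieltjes_version dE nconst p1 (class_fun_measurable f) m0
  (hV f) (borel_version0 g)).
have E : (\int[lebesgue_measure]_x emodulus_pow p (cont f x) = \int[lebesgue_measure]_x
    emodulus_pow p (comp_pseudoinverse g (V f) x - comp_pseudoinverse g (fun=> 0) x)%R)%E.
  apply: eq_integral => x _; rewrite /comp_pseudoinverse.
  by rewrite [in X in (_ - X)%R]patchE /=; case: ifP; rewrite subr0.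
move=> lty; split; last rewrite E; apply: le_lt_trans lty.
- by apply: leeDl; apply: integral_ge0 => x _; exact: emodulus_pow_ge0.
- apply: leeDr; apply: esum_ge0 => i.
  exact: (weighted_pow_term_ge0 p weight0 (val_jump f) (fun=> 0)).
Qed.

Lemma conditions_of_totally_bounded : totally_bounded (Lp_dist p) G ->
  [/\ forall n, I n ->
        exists M : R, forall f, G f -> modulus (class_fun f (d n)) <= M,
      forall eps : R, 0 < eps -> exists n : nat, forall f, G f ->
        (\esum_(i in I `&` [set i | (n < i)%N])
            (modulus (class_fun f (d i)) `^ p * jump g (d i))%:E
          < (eps `^ p)%:E)%E,
      forall eps : R, 0 < eps -> exists r : R, forall f, G f ->
        (\int[completed_lebesgue_measure]_(x in [set x : R | (r < `|x|)%R])
            (modulus (comp_pseudoinverse g (class_fun f) x) `^ p)%:E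
          < (eps `^ p)%:E)%E &
      forall eps : R, 0 < eps -> exists2 rho : R, 0 < rho &
        forall f (h : R), G f -> `|h| < rho ->
        (\int[completed_lebesgue_measure]_x
            (modulus (comp_pseudoinverse g (class_fun f) (x + h)
                      - comp_pseudoinverse g (class_fun f) x) `^ p)%:E
          < (eps `^ p)%:E)%E].
Proof.
move=> /totally_bounded_dist_pow tb; split.
- move=> n In; have [C [finC CG GC]] := tb _ ltr01.
  have wn : 0 < weight n by have [dI _ _] := dE; exact: dI.
  have : \forall M \near +oo, forall c, C c -> modulus (class_fun c (d n)) <= M.
    by apply: near_finite_set => // c _; exact: (nbhs_pinfty_ge (num_real _)).
  (* [M] bounds the values of the centres at [d n]. For an element near a centre, the p-th power of
     the difference is at most the inverse weight, so the difference is at most 1 or at most the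
     inverse weight. *)
  move=> /filter_ex[M hM]; exists (1 + (weight n)^-1 + M) => f Gf.
  have [c Cc cf] := GC f Gf.
  have h : modulus (class_fun f (d n) - class_fun c (d n)) <= 1 + (weight n)^-1.
    have : (emodulus_pow p (class_fun f (d n) - class_fun c (d n)) * (weight n)%:E < 1)%E.
      apply: le_lt_trans cf; rewrite dist_powC; apply: le_trans (jump_le_dist_pow f c).
      rewrite /weighted_pow (esumID [set n]) => [|i]; last first.
        exact: (weighted_pow_term_ge0 p weight0).
      have -> : I `&` [set n] = [set n] by apply/setIidPr => _ ->.
      rewrite esum_set1; last exact: (weighted_pow_term_ge0 p weight0 _ _ In).
      by rewrite leeDl//; apply: esum_ge0 => i [Ii _]; exact: (weighted_pow_term_ge0 p weight0).
    rewrite -EFinM lte_fin -ltr_pdivlMr// mul1r => /ltW h.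
    have [z1|/ltW z1] := leP (modulus (class_fun f (d n) - class_fun c (d n))) 1.
      by rewrite (le_trans z1)// lerDl invr_ge0 ltW.
    rewrite (le_trans _ (_ : (weight n)^-1 <= _)) ?lerDr// (le_trans _ h)//.
    by rewrite -[leLHS]powRr1 ?modulus_ge0// ler_powR.
  have := ler_modulusD (class_fun f (d n) - class_fun c (d n)) (class_fun c (d n)).
  rewrite subrK => /le_trans; apply.
  by apply: lerD => //; exact: hM.
- move=> e e0.
  pose S n f := weighted_pow p weight (I `&` [set i | (n < i)%N]) (val_jump f) (fun=> 0).
  have sI (n : nat) : I `&` [set i | (n < i)%N] `<=` I by exact: subIsetl.
  suff : \forall n \near \oo, forall f, G f -> (S n f < (e `^ p)%:E)%E.
    by move=> /filter_ex[n hn]; exists n => f /hn; rewrite tail_jumpE.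
  apply: (totally_bounded_near K0 tb).
  + move=> n f c Gf Gc.
    apply: le_trans (weighted_pow_triangle p1 weight0 (val_jump f) (val_jump c) (fun=> 0) (sI n)) _.
    apply: lee_wpmul2l; first by rewrite lee_fin ltW.
    apply: leeD2r; rewrite dist_powC; apply: le_trans (jump_le_dist_pow f c).
    rewrite /weighted_pow [leRHS](esumID [set i | (n < i)%N]) => [|i]; last first.
      exact: (weighted_pow_term_ge0 p weight0).
    by rewrite leeDl//; apply: esum_ge0 => i [Ii _]; exact: (weighted_pow_term_ge0 p weight0).
  + move=> c Gc; exact: (weighted_pow_tail weight0 (Lp_split Gc).1).
  + by rewrite powR_gt0.
- move=> e e0.
  pose S (n : nat) f := (\int[lebesgue_measure]_(x in [set x : R | (n%:R < `|x|)%R])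
    emodulus_pow p (cont f x))%E.
  suff : \forall n \near \oo, forall f, G f -> (S n f < (e `^ p)%:E)%E.
    by move=> /filter_ex[n hn]; exists n%:R => f /hn; rewrite tail_contE.
  apply: (totally_bounded_near K0 tb).
  + move=> n f c Gf Gc.
    apply: le_trans (integral_emodulus_le p1 lebesgue_measure (measurable_norm_gt n%:R)
      (mcont f) (mcont c)) _.
    apply: lee_wpmul2l; first by rewrite lee_fin ltW.
    apply: leeD2r; rewrite dist_powC; apply: le_trans (cont_le_dist_pow f c).
    apply: ge0_subset_integral; [exact: measurable_norm_gt|exact: measurableT| | |exact: subsetT].
      exact: (measurable_emodulus_pow p (scalar_measurableB (mcont f) (mcont c))).
    by move=> x _; exact: emodulus_pow_ge0.
  + move=> c Gc; apply: integral_tail_cvg; [|by move=> x; exact: emodulus_pow_ge0|].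
      exact: (measurable_emodulus_pow p (mcont c)).
    exact: (Lp_split Gc).2.
  + by rewrite powR_gt0.
- move=> e e0; pose K := (2 : R) `^ p.
  (* With [D] the distance and [S] the translation error of the centre, two quasi-triangle
     inequalities give K (D + K (S + D)). As K >= 1, the first D is at most K (D + S), and the total
     is at most 2 K^2 (D + S). *)
  have KK0 : 0 < 2 * (K * K) by rewrite mulr_gt0// mulr_gt0.
  pose S (h : R) f := (\int[lebesgue_measure]_x emodulus_pow p (cont f (x + h)%R - cont f x)%R)%E.
  suff : \forall h \near (0 : R), forall f, G f -> (S h f < (e `^ p)%:E)%E.
    move=> /nbhs_ballP[rho /= rho0 hrho]; exists rho => // f h Gf hh.
    by rewrite translate_contE; apply: hrho Gf; rewrite /ball/= sub0r normrN.
  apply: (@totally_bounded_near _ _ _ (nbhs (0 : R)) _ dist_pow G S _ KK0 tb).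
  + move=> h f c Gf Gc.
    have mh f' := scalar_measurable_shift h (mcont f').
    have K1 : 1 <= K by rewrite -[leLHS](powRr0 2) ler_powR// ?ler1n// ltW.
    have S0 : (0 <= S h c)%E by apply: integral_ge0 => x _; exact: emodulus_pow_ge0.
    have D0 : (0 <= dist_pow c f)%E by apply: integral_ge0 => x _; exact: emodulus_pow_ge0.
    apply: le_trans (integral_emodulus_triangle p1 lebesgue_measure measurableT
      (mh f) (mh c) (mcont f)) _.
    apply: (@le_trans _ _ (K%:E * (dist_pow c f + K%:E * (S h c + dist_pow c f)))%E).
      apply: lee_wpmul2l; first by rewrite lee_fin ltW.
      apply: leeD.
        rewrite (@integral_translate2 R p k (cont f) (cont c) h (mcont f) (mcont c)).
        by rewrite dist_powC; exact: cont_le_dist_pow.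
      apply: le_trans (integral_emodulus_triangle p1 lebesgue_measure measurableT
        (mh c) (mcont c) (mcont f)) _.
      apply: lee_wpmul2l; first by rewrite lee_fin ltW.
      by apply: leeD2l; exact: cont_le_dist_pow.
    have Ke0 : (0 <= K%:E)%E by rewrite lee_fin ltW.
    have X0 : (0 <= dist_pow c f + S h c)%E by exact: adde_ge0.
    have DX : (dist_pow c f <= K%:E * (dist_pow c f + S h c))%E.
      apply: le_trans (leeDl _ S0) _; rewrite -[leLHS]mul1e.
      by apply: lee_wpmul2r; rewrite ?lee_fin.
    apply: le_trans (lee_wpmul2l Ke0 (leeD2r _ DX)) _.
    rewrite (addeC (S h c)); move: X0; case: (dist_pow c f + S h c)%E => [r| |] // _.
      suff : ((K * (K * r + K * r))%:E <= (2 * (K * K) * r)%:E)%E by [].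
      by rewrite lee_fin; lra.
    by rewrite [leRHS]gt0_muley ?leey// lte_fin.
  + move=> c Gc r r0; apply/nbhs_ballP.
    have [rho rho0 hrho] := translation_continuous_scalar p1 (mcont c) (Lp_split Gc).2 r0.
    exists rho => //= h; rewrite /ball/= sub0r normrN; exact: hrho.
  + by rewrite powR_gt0.
Qed.

End assembly.

Theorem theorem4p12 (R : realType) (k : scalar_kind) (g : derivator R) (p : R)
    (I : set nat) (d : nat -> R) (G : set (mfun_class k g)) :
  (forall t, ~ exists c, forall s, s <= t -> cont_part g s = c) ->
  1 <= p ->
  enumeration (jump_set g) I d ->
  G `<=` Lp_set p ->
  totally_bounded (Lp_dist p) G <->
  [/\ forall n, I n ->
        exists M : R, forall f, G f -> modulus (class_fun f (d n)) <= M,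
      forall eps : R, 0 < eps -> exists n : nat, forall f, G f ->
        (\esum_(i in I `&` [set i | (n < i)%N])
            (modulus (class_fun f (d i)) `^ p * jump g (d i))%:E
          < (eps `^ p)%:E)%E,
      forall eps : R, 0 < eps -> exists r : R, forall f, G f ->
        (\int[completed_lebesgue_measure]_(x in [set x : R | (r < `|x|)%R])
            (modulus (comp_pseudoinverse g (class_fun f) x) `^ p)%:E
          < (eps `^ p)%:E)%E &
      forall eps : R, 0 < eps -> exists2 rho : R, 0 < rho &
        forall f (h : R), G f -> `|h| < rho ->
        (\int[completed_lebesgue_measure]_x
            (modulus (comp_pseudoinverse g (class_fun f) (x + h)
                      - comp_pseudoinverse g (class_fun f) x) `^ p)%:E
          < (eps `^ p)%:E)%E].
Proof.
move=> nconst p1 [_ dE] GLp.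
have [V hV] := choice (fun f : mfun_class k g => borel_version_ex f).
split; first exact: (conditions_of_totally_bounded nconst p1 dE GLp hV).
by case; exact: (totally_bounded_of_conditions nconst p1 dE hV).
Qed.
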